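(* Let $\alpha\in(0,1)$, $k\in[0,n/2)$ and let $Y\sim P$ with $P\in\mathcal P$. Provided that $n_1(P)\le k$, the set $$\mathcal S_{k,\alpha}=\big\{(\theta,\sigma)\in\mathbb R\times(0,\infty):\ \forall j\in\{0,\dots,n\},\ \widehat a_n(j;\Phi((\cdot-\theta)/\sigma))\le\widehat b_n(j;\Phi((\cdot-\theta)/\sigma))\big\}$$ is a $(1-\alpha)$-confidence region for the true scaling $(\theta(P),\sigma(P))$, i.e. $\mathbb P_{Y\sim P}\big((\theta(P),\sigma(P))\in\mathcal S_{k,\alpha}\big)\ge1-\alpha$. In particular, with probability at least $1-\alpha$, the oracle BH procedure $\mathrm{BH}^*_\alpha$ is one of the procedures $\mathrm{BH}_\alpha(u,s)$, $(u,s)\in\mathcal S_{k,\alpha}$.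
   Context: Setting. $Y=(Y_1,\dots,Y_n)$ has independent real coordinates, $Y_i\sim P_i$, $P=\otimes_{i=1}^nP_i$. $\mathcal P$ is the set of all such product distributions on $\mathbb R^n$ for which there exists $(\theta,\sigma)\in\mathbb R\times(0,\infty)$ with $|\{i: P_i=\mathcal N(\theta,\sigma^2)\}|>n/2$; this couple is unique and denoted $(\theta(P),\sigma(P))$. $n_1(P)=|\{i: P_i\ne\mathcal N(\theta(P),\sigma(P)^2)\}|$. $\Phi$ is the c.d.f. of $\mathcal N(0,1)$ and $\overline\Phi=1-\Phi$. BH. For $u\in\mathbb R$, $s>0$: $p_i(u,s)=2\overline\Phi(|Y_i-u|/s)$, $T_\alpha(Y;u,s)=\max\{t\in[0,1]:\sum_{i=1}^n\mathbf 1\{p_i(u,s)\le t\}\ge nt/\alpha\}$, $\mathrm{BH}_\alpha(u,s)=\{i: p_i(u,s)\le T_\alpha(Y;u,s)\}$, and $\mathrm{BH}^*_\alpha=\mathrm{BH}_\alpha(\theta(P),\sigma(P))$. Let $Y_{(1)}\le\dots\le Y_{(n)}$ be the order statistics, with $Y_{(0)}=-\infty$, $Y_{(n+1)}=+\infty$; for a c.d.f. $F_0$, $F_0(y^-)=\lim_{x\to y^-}F_0(x)$ (with $F_0(-\infty)=0$, $F_0(+\infty^-)=1$). Write $x\vee y=\max(x,y)$, $x\wedge y=\min(x,y)$. Let $c_{n,\alpha}=\{-(1-k/n)\log(\alpha/2)/(2n)\}^{1/2}$ and, for $j\in\{0,\dots,n\}$, $$\widehat a_n(j;F_0)=0\vee\frac{\max_{0\le\ell\le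 j}\{\ell/n-(1-k/n)F_0(Y_{(\ell)})\}-c_{n,\alpha}}{k/n},$$ $$\widehat b_n(j;F_0)=1\wedge\frac{\min_{j\le\ell\le n}\{\ell/n-(1-k/n)F_0(Y_{(\ell+1)}^-)\}+c_{n,\alpha}}{k/n}.$$ When $k=0$, quotients by $k/n=0$ are understood as $+\infty$, $-\infty$ or $0$ according to whether the numerator is positive, negative or zero. *)

(* Defs.v *)
From HB Require Import structures.
From mathcomp Require Import all_boot all_order all_algebra.
From mathcomp Require Import all_classical all_reals all_analysis.

Set Implicit Arguments.
Unset Strict Implicit.
Unset Printing Implicit Defensive.

Import Order.TTheory GRing.Theory Num.Theory.
Import numFieldNormedType.Exports.

Local Open Scope classical_set_scope.
Local Open Scope ring_scope.

(* Measures in the library are functions on all subsets, so equality of laws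
   has to be restricted to the Borel sets. *)
Definition same_law (R : realType) (mu nu : set R -> \bar R) : Prop :=
  forall A : set R, measurable A -> mu A = nu A.

Definition independent_RVs (d : measure_display) (Omega : measurableType d)
    (R : realType) (Pr : probability Omega R) (n : nat)
    (Y : 'I_n -> {RV Pr >-> R}) : Prop :=
  forall (J : {set 'I_n}) (B : 'I_n -> set R),
    (forall i, i \in J -> measurable (B i)) ->
    Pr (\bigcap_(i in [set` J]) (Y i @^-1` B i)) =
    \big[mule/1%E]_(i in J) Pr (Y i @^-1` B i).

(* A product distribution on R^n is represented by the family of its
   marginals P_1, ..., P_n. *)
Definition product_law (R : realType) (n : nat) :=
  'I_n -> probability (measurableTypeR R) R.

Definition has_product_law (d : measure_display) (Omega : measurableType d)
    (R : realType) (Pr : probability Omega R) (n : nat)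
    (Y : 'I_n -> {RV Pr >-> R}) (P : product_law R n) : Prop :=
  independent_RVs Y /\ forall i, same_law (distribution Pr (Y i)) (P i).

(* The second parameter of [normal_prob] is the standard deviation. *)
Definition null_set (R : realType) (n : nat) (P : product_law R n)
    (theta sigma : R) : {set 'I_n} :=
  [set i : 'I_n | `[< same_law (P i) (normal_prob theta sigma) >]]%SET.

Definition majority_null (R : realType) (n : nat) (P : product_law R n) :
    set (R * R) :=
  [set ts | 0 < ts.2 /\ n%:R / 2 < #|null_set P ts.1 ts.2|%:R :> R].

Definition in_calP (R : realType) (n : nat) (P : product_law R n) : Prop :=
  exists ts : R * R, majority_null P ts.

(* The default value (0, 1) is irrelevant when [in_calP P] holds. *)
Definition true_scaling (R : realType) (n : nat) (P : product_law R n) :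
    R * R :=
  xget (0, 1) (majority_null P).

Definition thetaP (R : realType) (n : nat) (P : product_law R n) : R :=
  (true_scaling P).1.

Definition sigmaP (R : realType) (n : nat) (P : product_law R n) : R :=
  (true_scaling P).2.

Definition n1 (R : realType) (n : nat) (P : product_law R n) : nat :=
  #|(~: null_set P (thetaP P) (sigmaP P))%SET|.

Definition Phi (R : realType) (x : R) : R :=
  fine (normal_prob (0 : R) 1 `]-oo, x]).

Definition barPhi (R : realType) (x : R) : R := 1 - Phi x.

Definition scaled_cdf (R : realType) (theta sigma : R) : R -> R :=
  fun x => Phi ((x - theta) / sigma).

Definition pvalue (R : realType) (n : nat) (y : n.-tuple R) (u s : R)
    (i : 'I_n) : R :=
  2 * barPhi (`|tnth y i - u| / s).

(* For alpha > 0 the set contains 0 and is compact (the counting function is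
   nondecreasing and right-continuous), so its supremum is its maximum. *)
Definition BH_threshold (R : realType) (n : nat) (alpha : R) (y : n.-tuple R)
    (u s : R) : R :=
  sup [set t : R | 0 <= t <= 1 /\
    n%:R * t / alpha <= \sum_(i < n) (pvalue y u s i <= t)%R%:R].

(* A procedure is a function of the data; BH(u, s) is [BH alpha u s]. *)
Definition BH (R : realType) (n : nat) (alpha u s : R) :
    n.-tuple R -> {set 'I_n} :=
  fun y =>
    [set i : 'I_n | pvalue y u s i <= BH_threshold alpha y u s]%SET.

Definition oracle_BH (R : realType) (n : nat) (alpha : R)
    (P : product_law R n) : n.-tuple R -> {set 'I_n} :=
  BH alpha (thetaP P) (sigmaP P).

(* Y_(l) for 0 <= l <= n + 1, with Y_(0) = -oo and Y_(n+1) = +oo. *)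
Definition order_stat (R : realType) (n : nat) (y : n.-tuple R) (l : nat) :
    \bar R :=
  if l == 0%N then -oo%E
  else if (l <= n)%N then (nth 0 (sort <=%R y) l.-1)%:E
  else +oo%E.

Definition cdf_at (R : realType) (F0 : R -> R) (x : \bar R) : R :=
  match x with
  | r%:E => F0 r
  | -oo%E => 0
  | +oo%E => 1
  end.

Definition cdf_left (R : realType) (F0 : R -> R) (x : \bar R) : R :=
  match x with
  | r%:E => lim (F0 x @[x --> r^'-])
  | -oo%E => 0
  | +oo%E => 1
  end.

(* For x / 0, the value is +oo, -oo or 0 according to the sign of x. *)
Definition ext_quot (R : realType) (x d : R) : \bar R :=
  if d == 0 then
    if 0 < x then +oo%E else if x < 0 then -oo%E else 0%E
  else (x / d)%:E.

Definition c_na (R : realType) (n : nat) (k alpha : R) : R :=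
  Num.sqrt (- (1 - k / n%:R) * ln (alpha / 2) / (2 * n%:R)).

(* In [a_hat] and [b_hat], for j <= n, the initial value of the iterated
   max (resp. min) is the term of index 0 (resp. n), which belongs to the
   range: it does not affect the result. *)
Definition a_term (R : realType) (n : nat) (k : R) (y : n.-tuple R)
    (F0 : R -> R) (l : nat) : R :=
  l%:R / n%:R - (1 - k / n%:R) * cdf_at F0 (order_stat y l).

Definition a_hat (R : realType) (n : nat) (k alpha : R) (y : n.-tuple R)
    (F0 : R -> R) (j : nat) : \bar R :=
  maxe 0%E (ext_quot
    (\big[Num.max/a_term k y F0 0]_(0 <= l < j.+1) a_term k y F0 l
       - c_na n k alpha)
    (k / n%:R)).

Definition b_term (R : realType) (n : nat) (k : R) (y : n.-tuple R)
    (F0 : R -> R) (l : nat) : R :=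
  l%:R / n%:R - (1 - k / n%:R) * cdf_left F0 (order_stat y l.+1).

Definition b_hat (R : realType) (n : nat) (k alpha : R) (y : n.-tuple R)
    (F0 : R -> R) (j : nat) : \bar R :=
  mine 1%E (ext_quot
    (\big[Num.min/b_term k y F0 n]_(j <= l < n.+1) b_term k y F0 l
       + c_na n k alpha)
    (k / n%:R)).

Definition conf_region (R : realType) (n : nat) (k alpha : R)
    (y : n.-tuple R) : set (R * R) :=
  [set ts | 0 < ts.2 /\
    forall j : nat, (j <= n)%N ->
      (a_hat k alpha y (scaled_cdf ts.1 ts.2) j <=
       b_hat k alpha y (scaled_cdf ts.1 ts.2) j)%E].

Definition sample (d : measure_display) (Omega : measurableType d)
    (R : realType) (Pr : probability Omega R) (n : nat)
    (Y : 'I_n -> {RV Pr >-> R}) (omega : Omega) : n.-tuple R :=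
  [tuple Y i omega | i < n].

(* Main.v *)
Require Import Defs.
From mathcomp Require Import all_boot all_order all_algebra.
From mathcomp Require Import all_classical all_reals all_analysis.
From mathcomp Require Import measurable_realfun ring lra.

Set Implicit Arguments.
Unset Strict Implicit.
Unset Printing Implicit Defensive.

Import Order.TTheory GRing.Theory Num.Theory.
Import numFieldNormedType.Exports.

Local Open Scope classical_set_scope.
Local Open Scope ring_scope.

(** The region is an inversion of a two-sided Dvoretzky-Kiefer-Wolfowitz band
with the optimal constant, stretched to allow for the outliers. The proof has
two ingredients.

Probability. Let [m] independent uniform variables have empirical count [N],
and let [s |-> lam * s + a] be a line with [a > 0] that ends at height [b]
above [m] at [s = 1], [b = lam + a - m >= 0]. Then
   [P (exists s, N s > lam * s + a) <= exp (- 6 a b / (2 lam + m))].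
For [lam = m] and [a = b] this is the one-sided inequality
[exp (- 2 a^2 / m)], without any restriction on the level. The reason is a
supermartingale, read from [s = 1] downwards. Rescale so that the line has
slope one; at a time [T] at which [m] points remain in [[0, T]], they are
uniform there, and the gap to the line is [b = T + a - m]. The process
[exp (- 6 a (T + a - m) / (2 T + m))] equals [1] when the gap closes, so it
bounds the crossing probability as soon as it is a supermartingale. For a
Brownian bridge of variance [m] the exact value is [exp (- 2 a b / m)]; the
mixture [(2 T + m) / 3] of [T] and [m] in the denominator is the one for which
the first-order correction due to the jumps vanishes identically, and with it
the supermartingale inequality holds exactly ([bernstein_drift],
[crossing_exp_drift]). To avoid continuous-time martingales, times run through
a finite grid: integrating the drift inequality gives the one-step bound
[shifted_weight_le], an induction along the grid gives [Pr_crossed], and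
refining the grid gives [linear_crossing_two_sided].

Geometry. Put [L = n - k], let [n1] be the number of outliers,
[f = k - n1 >= 0], and [c = n * c_na n k alpha], so that the null points
number [L + f] and [2 c^2 / L = ln (2 / alpha)]. When [f > 0] the level
[c_na] is calibrated for fewer points than there are nulls, and with neither a
parallel nor a proportional shift of the band does the above bound stay below
[alpha / 2] on both sides. Tilted lines solve this: with
   [x = 2 c f / (L + 2 c)] and [t = L f / (L + 2 c)], [x + t = f],
suppose that the count of the transformed nulls stays below
[(L + t) s + c + x], and that the count of the reflected ones does too.
Then the true scaling passes every test. Indeed the lower and upper tests at points
[u < v] can only conflict if [L (F v - F u) > 2 c], and over such a distance
the tilt has gained exactly what is missing ([tilted_band]). The crossing bound
for these lines, with [a = c + x] and [b = c], has an exponent of at least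
[2 c^2 / L] ([tilted_rate_ge]), so that each of the two sides fails with
probability at most [alpha / 2]; this holds for [2 c <= 3 L], and for larger
[c] the lines start above the number of nulls. *)

(** * An exponential inequality *)

Lemma ge0_derive_le (R : realType) (f df : R -> R) (a b : R) :
  a <= b ->
  (forall x, a <= x <= b -> is_derive x 1 f (df x)) ->
  (forall x, a <= x <= b -> 0 <= df x) ->
  f a <= f b.
Proof.
move=> ab fd df0.
have dfi x : x \in `]a, b[ -> is_derive x 1 f (df x).
  by rewrite in_itv /= => /andP[ax xb]; apply: fd; rewrite !ltW.
have cf : {within `[a, b], continuous f}.
  apply: derivable_within_continuous => x; rewrite in_itv /= => xab.
  by have := fd x xab => /@ex_derive.
have [c cab eqc] := MVT_segment ab dfi cf.
rewrite -subr_ge0 eqc mulr_ge0 ?subr_ge0 //; apply: df0.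
by move: cab; rewrite in_itv.
Qed.

Lemma expR_ge_quad (R : realType) (x : R) :
  0 <= x -> 1 + x + x ^+ 2 / 2 <= expR x.
Proof.
move=> x0.
suff : expR 0 - (1 + 0 + 0 ^+ 2 / 2) <= expR x - (1 + x + x ^+ 2 / 2) :> R.
  rewrite expR0; lra.
pose f (y : R) := expR y - (1 + y + y ^+ 2 / 2).
apply: (@ge0_derive_le _ f (fun y => expR y - (1 + y))) => // y _.
- rewrite /f; apply: is_derive_eq.
  by rewrite /GRing.scale /=; field.
- by rewrite subr_ge0 expR_ge1Dx.
Qed.

(** The second-order Pade approximant of the exponential; a coarser bound would
lose the cubic term that makes [bernstein_drift] hold near the line. The
difference of the two sides and its first derivative vanish at 0, and the second
derivative is nonnegative by [expR_ge_quad]. *)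
Lemma expRN_pade (R : realType) (x : R) :
  0 <= x -> x <= (1 - expR (- x)) * (1 + x / 2 + x ^+ 2 / 12).
Proof.
move=> x0.
pose f1 (y : R) := - (1/2) + y / 6 + expR (- y) * (1 / 2 + y / 3 + y ^+ 2 / 12).
pose f (y : R) := 1 - y / 2 + y ^+ 2 / 12
  - expR (- y) * (1 + y / 2 + y ^+ 2 / 12).
have f1_ge0 y : 0 <= y -> 0 <= f1 y.
  move=> y0.
  have <- : f1 0 = 0 by rewrite /f1 oppr0 expR0; lra.
  apply: (@ge0_derive_le _ f1
    (fun y => (1 - expR (- y) * (1 + y + y ^+ 2 / 2)) / 6)) => // z zy.
  - rewrite /f1; apply: is_derive_eq.
    by rewrite /GRing.scale /=; field.
  - have := @expR_ge_quad _ z; case/andP: zy => z0 _ /(_ z0) h.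
    rewrite divr_ge0 // subr_ge0 expRN mulrC ler_pdivrMr ?mul1r //.
    exact: expR_gt0.
have f_ge0 : 0 <= f x.
  have <- : f 0 = 0 by rewrite /f oppr0 expR0; lra.
  apply: (@ge0_derive_le _ f f1) => // z zy.
  - rewrite /f /f1; apply: is_derive_eq.
    by rewrite /GRing.scale /=; field.
  - by apply: f1_ge0; case/andP: zy.
move: f_ge0; rewrite /f; lra.
Qed.

(** For fixed [b] the product of the factors containing [a] is a concave
quadratic in [a]; at its maximum the claim becomes
[(1 - 2 b) (1 + b + b^2 / 2)^2 <= 1] after normalising [S = 1], which holds
since the two factors are at most [exp (- 2 b)] and [exp (2 b)]. *)
Lemma quintic_le (R : realType) (a b S : R) :
  0 <= a -> 0 <= b -> 0 < S -> 0 <= S + b - a ->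
  (S + b - a) * (S - b *+ 2) * (S + b) * (S ^+ 2 + a * (S + b)) <= S ^+ 5.
Proof.
move=> a0 b0 S0 h1.
have q0 : 0 <= S ^+ 2 + a * (S + b).
  by rewrite addr_ge0 ?sqr_ge0 // mulr_ge0 //; lra.
have [h2|h2] := leP (S - b *+ 2) 0.
  apply: (@le_trans _ _ 0); last by rewrite exprn_ge0 // ltW.
  have h3 : 0 <= (S + b - a) * (S + b) * (S ^+ 2 + a * (S + b)).
    by rewrite !mulr_ge0 //; lra.
  have := mulr_le0_ge0 h2 h3; lra.
have h4 : (S + b - a) * (S ^+ 2 + a * (S + b)) * (S + b)
    <= (S ^+ 2 + S * b + b ^+ 2 / 2) ^+ 2.
  rewrite -subr_ge0.
  have -> : (S ^+ 2 + S * b + b ^+ 2 / 2) ^+ 2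
      - (S + b - a) * (S ^+ 2 + a * (S + b)) * (S + b)
    = (((S + b) ^+ 2 - S ^+ 2) / 2 - a * (S + b)) ^+ 2 by field.
  exact: sqr_ge0.
have h5 := ler_wpM2r (ltW h2) h4.
have h6 : (S ^+ 2 + S * b + b ^+ 2 / 2) ^+ 2 * (S - b *+ 2) <= S ^+ 5.
  rewrite -subr_ge0.
  have -> : S ^+ 5 - (S ^+ 2 + S * b + b ^+ 2 / 2) ^+ 2 * (S - b *+ 2)
    = b ^+ 2 * (S ^+ 3 *+ 2 + S ^+ 2 * b *+ 3 + S * b ^+ 2 * (7 / 4)
       + b ^+ 3 / 2) by field.
  by rewrite mulr_ge0 ?sqr_ge0 // !addr_ge0 ?mulrn_wge0 ?mulr_ge0 ?exprn_ge0
    // ltW.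
lra.
Qed.

(** The generator inequality behind the supermartingale
[exp (- 6 a (T + a - m) / (2 T + m))]: the left side is [T] times the time
derivative of the exponent; the right side is the effect of losing one of the
[m] points, when the jump of the exponent is replaced by its derivative in
[m]. *)
Lemma bernstein_drift (R : realType) (a m T S : R) :
  0 < a -> 0 < m -> 0 < T -> m <= T + a -> S = T *+ 2 + m ->
  6 * a * T * (m *+ 3 - a *+ 2) / S ^+ 2
    <= m * (1 - expR (- (6 * a * (T *+ 3 + a) / S ^+ 2))).
Proof.
move=> a0 m0 T0 mTa eS.
have S0 : 0 < S by rewrite eS; lra.
set b := T + a - m; have b0 : 0 <= b by rewrite /b; lra.
have eT : T *+ 3 = S + b - a by rewrite eS /b; ring.
have em : m *+ 3 - a *+ 2 = S - b *+ 2 by rewrite eS /b; ring.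
set x := 6 * a * (T *+ 3 + a) / S ^+ 2.
have x0 : 0 <= x by rewrite divr_ge0 ?mulr_ge0 ?sqr_ge0 //; lra.
set q := 1 + x / 2 + x ^+ 2 / 12.
have q0 : 0 < q.
  have := sqr_ge0 x; rewrite /q; lra.
have pade : m * x <= m * (1 - expR (- x)) * q.
  by rewrite -mulrA ler_pM2l //; exact: expRN_pade.
have key : 6 * a * T * (m *+ 3 - a *+ 2) / S ^+ 2 * q <= m * x.
  have := @quintic_le _ a b S (ltW a0) b0 S0.
  have T30 : 0 <= S + b - a by rewrite -eT mulrn_wge0 // ltW.
  move=> /(_ T30) Q.
  rewrite -subr_ge0.
  have -> : m * x - 6 * a * T * (m *+ 3 - a *+ 2) / S ^+ 2 * q
    = 6 * a ^+ 2 / S ^+ 6 * (S ^+ 5 -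
      (S + b - a) * (S - b *+ 2) * (S + b) * (S ^+ 2 + a * (S + b))).
    have eu : S + b = T *+ 3 + a by rewrite eT; ring.
    have em' : m = S - T *+ 2 by rewrite eS; ring.
    rewrite -eT -em eu /q /x em'; field.
    by rewrite gt_eqF.
  by rewrite mulr_ge0 ?subr_ge0 // divr_ge0 ?mulr_ge0 ?sqr_ge0 ?exprn_ge0 ?ltW.
by rewrite -(ler_pM2r q0); apply: le_trans key pade.
Qed.

(** * Weights dominating the crossing volumes *)

(** The Brownian-bridge exponent [2 * a * b / v] for the gaps [a] at the origin
and [b = T + a - m] at [T], with the variance [v = (2 * T + m) / 3]. *)
Definition crossing_rate (R : realType) (a m T : R) : R :=
  6 * a * (T + a - m) / (T *+ 2 + m).

(** [T ^+ m] is the volume of all configurations of [m] points in [[0, T]]; the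
weight is an upper bound on the volume of those whose count reaches the line
[s + a] at some [s <= T]. The second branch is the case where the line has
already been crossed at [T]. *)
Definition crossing_weight (R : realType) (a : R) (m : nat) (T : R) : R :=
  if m%:R <= T + a then T ^+ m * expR (- crossing_rate a m%:R T) else T ^+ m.

Section CrossingWeight.
Variables (R : realType) (a : R).
Hypothesis a0 : 0 < a.

Lemma crossing_weight_ge0 m (T : R) : 0 <= T -> 0 <= crossing_weight a m T.
Proof.
move=> T0; rewrite /crossing_weight; case: ifP => _; last exact: exprn_ge0.
by rewrite mulr_ge0 ?exprn_ge0 ?expR_ge0.
Qed.

Lemma crossing_weight_le_pow m (T : R) : 0 <= T -> crossing_weight a m T <= T ^+ m.
Proof.
move=> T0; rewrite /crossing_weight; case: ifP => // mT.
rewrite ler_piMr ?exprn_ge0 // -[leRHS]expR0 ler_expR oppr_le0 /crossing_rate.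
by rewrite divr_ge0 ?mulr_ge0 ?subr_ge0 ?addr_ge0 ?mulrn_wge0 // ltW.
Qed.

(** Beyond the line the exponential exceeds 1, so that one formula bounds both
branches. *)
Lemma crossing_weight_le_exp m (T : R) : 0 < T ->
  crossing_weight a m T <= T ^+ m * expR (- crossing_rate a m%:R T).
Proof.
move=> T0; rewrite /crossing_weight; case: ifPn => //; rewrite -ltNge => mT.
rewrite ler_peMr ?exprn_ge0 ?(ltW T0) //.
rewrite -[leLHS]expR0 ler_expR oppr_ge0 ltW //.
rewrite pmulr_llt0 ?invr_gt0; first by rewrite pmulr_rlt0 ?mulr_gt0 // subr_lt0.
by rewrite ltr_wpDr ?mulrn_wgt0.
Qed.

Lemma is_derive_crossing_exp m (T : R) : 0 < T ->
  is_derive T 1 (fun z => z ^+ m.+1 * expR (- crossing_rate a m.+1%:R z))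
    (T ^+ m * expR (- crossing_rate a m.+1%:R T) *
     (m.+1%:R - 6 * a * T * (m.+1%:R *+ 3 - a *+ 2) / (T *+ 2 + m.+1%:R) ^+ 2)).
Proof.
move=> T0; rewrite /crossing_rate; set M : R := m.+1%:R.
have M0 : 0 < M by rewrite ltr0n.
have dn0 : T *+ 2 + M != 0 by rewrite gt_eqF // addr_gt0 ?mulrn_wgt0.
have dden : is_derive T 1 (fun z : R => z *+ 2 + M) 2.
  by apply: (@is_derive_eq _ _ _ (fun z : R => z + z + M)); rewrite addr0.
have dinv := @is_deriveV R (fun z : R => z *+ 2 + M) T 2 1 dn0 dden.
have dnum : is_derive T 1 (fun z : R => 6 * a * (z + a - M)) (6 * a).
  apply: is_derive_eq; rewrite /GRing.scale /=; ring.
have dquo := is_deriveM dnum dinv.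
have dexp := is_derive1_comp (is_derive_expR _) (is_deriveN dquo).
have dpow : is_derive T 1 (fun z : R => z ^+ m.+1) (M * T ^+ m).
  have := is_deriveX m.+1 (is_derive_id T (1 : R)).
  rewrite exprfctE /GRing.scale /= mulr1; exact.
apply: (is_derive_eq (is_deriveM dpow dexp)).
rewrite /GRing.scale /= exprS.
rewrite [X in expR X](_ : _ = - (6 * a * (T + a - M) / (T *+ 2 + M))) //.
by clearbody M; move: (expR _) => E; field; rewrite mulr_natr.
Qed.

(** The volumes [v_m] of crossing configurations satisfy [v_m' = m v_(m-1)], by
placing one of the [m] points at the right end; the weights have to satisfy
[w_m' >= m w_(m-1)] in order to dominate them. The step from [m.+1] to [m]
points increases the exponent by at least its derivative in the number of
points, which leads back to [bernstein_drift]. *)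
Lemma crossing_exp_drift m (T : R) : 0 < T -> m.+1%:R <= T + a ->
  m.+1%:R * crossing_weight a m T <=
  T ^+ m * expR (- crossing_rate a m.+1%:R T) *
  (m.+1%:R - 6 * a * T * (m.+1%:R *+ 3 - a *+ 2) / (T *+ 2 + m.+1%:R) ^+ 2).
Proof.
move=> T0 mT; set M : R := m.+1%:R.
have M0 : 0 < M by rewrite ltr0n.
set S := T *+ 2 + M.
have S1 : 0 < S - 1.
  rewrite /S /M -natr1 addrA addrK ltr_wpDr // mulrn_wgt0 //.
have S0 : 0 < S by rewrite (lt_trans S1) // gtrBl.
have drift := @bernstein_drift R a M T S a0 M0 T0 mT erefl.
set Dl := 6 * a * (T *+ 3 + a) / S ^+ 2 in drift *.
have D_le : crossing_rate a M T + Dl <= crossing_rate a m%:R T.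
  have -> : m%:R = M - 1 :> R by rewrite /M -natr1 addrK.
  rewrite -subr_ge0 /crossing_rate.
  have -> : T *+ 2 + (M - 1) = S - 1 by rewrite addrA.
  rewrite -/S /Dl.
  have -> : 6 * a * (T + a - (M - 1)) / (S - 1) -
     (6 * a * (T + a - M) / S + 6 * a * (T *+ 3 + a) / S ^+ 2) =
     6 * a * (T *+ 3 + a) / (S ^+ 2 * (S - 1)).
    have -> : M = S - T *+ 2 by rewrite /S addrC addKr.
    by move: S S0 S1 {drift Dl} => S S0 S1; field; rewrite !gt_eqF.
  by rewrite ltW // divr_gt0 ?mulr_gt0 ?exprn_gt0 // addr_gt0 ?mulrn_wgt0.
have W_le := crossing_weight_le_exp m T0.
apply: le_trans (ler_wpM2l (ltW M0) W_le) _.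
have e_le : expR (- crossing_rate a m%:R T)
    <= expR (- crossing_rate a M T) * expR (- Dl).
  by rewrite -expRD ler_expR -opprD lerN2.
rewrite mulrCA -[leRHS]mulrA ler_pM2l ?exprn_gt0 //.
apply: le_trans (ler_wpM2l (ltW M0) e_le) _.
rewrite mulrCA ler_pM2l ?expR_gt0 //.
rewrite lerBrDl -lerBrDr; apply: le_trans drift _.
by rewrite mulrBr mulr1.
Qed.

(** The weight of [m] points in [[0, t + d]] when the crossing happens before
[t], sorted by the number [j] of points in [[0, t]]. *)
Definition shifted_weight (t : R) (m : nat) (d : R) : R :=
  \sum_(j < m.+1) d ^+ (m - j) * crossing_weight a j t *+ 'C(m, j).

Lemma is_derive_shifted_weight (t d : R) m :
  is_derive d 1 (shifted_weight t m.+1) (m.+1%:R * shifted_weight t m d).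
Proof.
pose h (j : 'I_m.+2) (z : R) : R :=
  z ^+ (m.+1 - j) * (crossing_weight a j t *+ 'C(m.+1, j)).
pose dh (j : 'I_m.+2) : R :=
  (m.+1 - j)%:R * d ^+ (m.+1 - j).-1 * (crossing_weight a j t *+ 'C(m.+1, j)).
have hd j : is_derive d 1 (h j) (dh j).
  have := is_deriveX (m.+1 - j) (is_derive_id d (1 : R)).
  rewrite exprfctE /GRing.scale /= mulr1 => dX.
  have dC := is_derive_cst (crossing_weight a j t *+ 'C(m.+1, j)) d (1 : R).
  apply: (is_derive_eq (is_deriveM dX dC)).
  by rewrite /GRing.scale /= mulr0 add0r mulrC.
have -> : shifted_weight t m.+1 = \sum_(j < m.+2) h j.
  apply/funext => z; rewrite fct_sumE /shifted_weight; apply: eq_bigr => j _.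
  by rewrite /h mulrnAr.
apply: (is_derive_eq (is_derive_sum hd)).
rewrite big_ord_recr /= {2}/dh /= subnn !mul0r addr0 mulr_sumr.
apply: eq_bigr => j _; rewrite /dh /=.
have jm : (j <= m)%N by rewrite -ltnS.
have e : (m.+1 - j)%:R * ('C(m.+1, j))%:R = m.+1%:R * ('C(m, j))%:R :> R.
  by rewrite -!natrM -mul_bin_down.
have -> : (m.+1 - j).-1 = (m - j)%N by rewrite subSn.
rewrite -[X in _ * X]mulr_natr -[X in _ = _ * X]mulr_natr.
move: (_%:R) (_%:R) (_%:R) (_%:R) e => A B C D e.
transitivity (D * C * (d ^+ (m - j) * crossing_weight a j t)); first by ring.
by rewrite e; ring.
Qed.

Lemma shifted_weight0 (t : R) m :
  shifted_weight t m 0 = crossing_weight a m t.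
Proof.
rewrite /shifted_weight big_ord_recr /= subnn expr0 mul1r binn mulr1n.
rewrite big1 ?add0r // => j _.
by rewrite expr0n subn_eq0 leqNgt ltn_ord /= mul0r mul0rn.
Qed.

Lemma shifted_weight_le_pow (t d : R) m : 0 <= t -> 0 <= d ->
  shifted_weight t m d <= (t + d) ^+ m.
Proof.
move=> t0 d0; rewrite addrC exprDn /shifted_weight; apply: ler_sum => j _.
rewrite lerMn2r; apply/orP; right.
by rewrite ler_wpM2l ?exprn_ge0 ?crossing_weight_le_pow.
Qed.

(** Both sides are functions of [d] that agree at [d = 0]; their derivatives
compare by induction on [m] and [crossing_exp_drift]. *)
Lemma shifted_weight_le (t d : R) m : 0 < t -> 0 <= d ->
  shifted_weight t m d <= crossing_weight a m (t + d).
Proof.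
move=> t0; elim: m d => [|m IHm] d d0.
  rewrite /shifted_weight big_ord1 subnn expr0 mul1r bin0 mulr1n.
  have w0 (z : R) : 0 < z ->
      crossing_weight a 0 z = expR (- (6 * a * (z + a) / (z *+ 2))).
    move=> z0; rewrite /crossing_weight /crossing_rate mulr0n subr0 addr0.
    by rewrite addr_ge0 ?ltW // expr0 mul1r.
  have td0 : 0 < t + d by rewrite ltr_wpDr.
  rewrite /= !w0 // ler_expR lerN2.
  rewrite -subr_ge0.
  have -> : 6 * a * (t + a) / (t *+ 2) - 6 * a * (t + d + a) / ((t + d) *+ 2)
     = 3 * a ^+ 2 * d / (t * (t + d)) by field; rewrite !gt_eqF.
  by rewrite divr_ge0 ?mulr_ge0 ?exprn_ge0 // ltW.
have td0 (z : R) : 0 <= z -> 0 < t + z by move=> z0; rewrite ltr_wpDr.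
have [mtd|mtd] := leP m.+1%:R (t + d + a); last first.
  have -> : crossing_weight a m.+1 (t + d) = (t + d) ^+ m.+1.
    by rewrite /crossing_weight leNgt mtd.
  exact: shifted_weight_le_pow (ltW t0) d0.
pose W (z : R) := (t + z) ^+ m.+1 * expR (- crossing_rate a m.+1%:R (t + z)).
pose dW (z : R) := (t + z) ^+ m * expR (- crossing_rate a m.+1%:R (t + z)) *
  (m.+1%:R - 6 * a * (t + z) * (m.+1%:R *+ 3 - a *+ 2)
     / ((t + z) *+ 2 + m.+1%:R) ^+ 2).
have W_eq z : m.+1%:R <= t + z + a -> crossing_weight a m.+1 (t + z) = W z.
  by rewrite /crossing_weight => ->.
(* Until [d1] the line is below [m.+1] and the weight is a plain volume. *)
pose d1 : R := Num.max 0 (m.+1%:R - a - t).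
have d10 : 0 <= d1 by rewrite /d1 le_max lexx.
have d1d : d1 <= d by rewrite /d1 ge_max d0 /= !lerBlDr; lra.
have d1m : m.+1%:R <= t + d1 + a.
  have : m.+1%:R - a - t <= d1 by rewrite /d1 le_max lexx orbT.
  lra.
have start : shifted_weight t m.+1 d1 <= W d1.
  rewrite -W_eq //; have [e|e] := leP (m.+1%:R - a - t) 0.
    have -> : d1 = 0 by rewrite /d1; apply/max_idPl.
    by rewrite shifted_weight0 addr0.
  have ed1 : d1 = m.+1%:R - a - t by rewrite /d1; apply/max_idPr/ltW.
  apply: le_trans (shifted_weight_le_pow _ (ltW t0) d10) _.
  rewrite /crossing_weight d1m.
  have -> : crossing_rate a m.+1%:R (t + d1) = 0.
    have e0 : t + d1 + a - m.+1%:R = 0 by rewrite ed1; ring.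
    by rewrite /crossing_rate e0 mulr0 mul0r.
  by rewrite oppr0 expR0 mulr1.
rewrite W_eq // -subr_ge0.
apply: (@le_trans _ _ (W d1 - shifted_weight t m.+1 d1)).
  by rewrite subr_ge0.
apply: (@ge0_derive_le _ (fun z => W z - shifted_weight t m.+1 z)
  (fun z => dW z - m.+1%:R * shifted_weight t m z)) => // z /andP[d1z zd].
- have z0 := le_trans d10 d1z.
  apply: is_deriveB; last exact: is_derive_shifted_weight.
  have dt : is_derive z 1 (fun y : R => t + y) 1.
    apply: (is_derive_eq (is_deriveD (is_derive_cst t z (1 : R)) (is_derive_id z (1 : R)))).
    by rewrite add0r.
  apply: (is_derive_eq (is_derive1_comp (is_derive_crossing_exp m (td0 z z0)) dt)).
  by rewrite mulr1.
- have z0 := le_trans d10 d1z.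
  rewrite subr_ge0.
  apply: le_trans (ler_wpM2l _ (IHm z z0)) _ => //.
  by apply: crossing_exp_drift; [exact: td0|lra].
Qed.

End CrossingWeight.

(** * Crossing a line along a grid *)

Lemma crossing_weight_top (R : realType) (a : R) (m : nat) (T : R) :
  T + a <= m%:R -> crossing_weight a m T = T ^+ m.
Proof.
rewrite /crossing_weight; case: ifP => // h1 h2.
have e : T + a - m%:R = 0 by apply/eqP; rewrite subr_eq0 eq_le h1 h2.
by rewrite /crossing_rate e mulr0 mul0r oppr0 expR0 mulr1.
Qed.

Lemma sum_subset_card (R : pzSemiRingType) (I : finType) (J : {set I})
    (f : nat -> R) :
  \sum_(J' in powerset J) f #|J'| = \sum_(j < #|J|.+1) f j *+ 'C(#|J|, j).
Proof.
pose c (J' : {set I}) : 'I_#|J|.+1 := inord #|J'|.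
have cE J' : J' \in powerset J -> c J' = #|J'| :> nat.
  by rewrite powersetE => /subset_leq_card h; rewrite inordK.
rewrite (partition_big c xpredT) //=; apply: eq_bigr => j _.
rewrite (eq_bigr (fun=> f j)); last by move=> J' /andP[/cE <- /eqP ->].
rewrite sumr_const -cards_draws; congr (_ *+ _); apply: eq_card => J'.
rewrite !inE unfold_in /= powersetE; apply: andb_id2l => J'J.
by rewrite -val_eqE /= cE ?powersetE.
Qed.

Lemma measure_bigU_le (d : measure_display) (T : measurableType d)
    (R : realType) (mu : {measure set T -> \bar R}) (I : finType)
    (Q : {pred I}) (A : I -> set T) :
  (forall i, measurable (A i)) ->
  (mu (\big[setU/set0]_(i in Q) A i) <= \sum_(i in Q) mu (A i))%E.
Proof.
move=> mA; rewrite -!big_enum /=; elim: (enum Q) => [|i s IHs].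
  by rewrite !big_nil measure0.
rewrite !big_cons; apply: le_trans (measureU2 _ _ _) _ => //.
  by apply: bigsetU_measurable.
by rewrite leeD2l.
Qed.

Section GridCrossing.
Context (d : measure_display) (Omega : measurableType d) (R : realType).
Variables (Pr : probability Omega R) (n : nat) (Y : 'I_n -> {RV Pr >-> R}).
Hypothesis indY : independent_RVs Y.

Definition cylinder (J : {set 'I_n}) (B : 'I_n -> set R) : set Omega :=
  \bigcap_(i in [set` J]) (Y i @^-1` B i).

Let p (i : 'I_n) (B : set R) : R := fine (Pr (Y i @^-1` B)).

Lemma cylinder_measurable (J : {set 'I_n}) (B : 'I_n -> set R) : (forall i, measurable (B i)) ->
  measurable (cylinder J B).
Proof.
move=> mB; apply: fin_bigcap_measurable; first exact: finite_finset.
by move=> i _; apply: measurable_funPTI.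
Qed.

Lemma Pr_cylinder (J : {set 'I_n}) (B : 'I_n -> set R) : (forall i, measurable (B i)) ->
  Pr (cylinder J B) = (\prod_(i in J) p i (B i))%:E.
Proof.
move=> mB; rewrite /cylinder indY; last by move=> i _; exact: mB.
rewrite (big_morph EFin (@EFinM R) erefl); apply: eq_bigr => i _.
by rewrite fineK // fin_num_measure //; exact: measurable_funPTI.
Qed.

Lemma cylinderI (J K : {set 'I_n}) (B C : 'I_n -> set R) : [disjoint J & K]%B ->
  cylinder J B `&` cylinder K C =
  cylinder (J :|: K) (fun i => if i \in J then B i else C i).
Proof.
move=> dJK; apply/seteqP; split => w /=.
  by move=> [hJ hK] i /=; rewrite inE; case: ifP => [iJ _|_ /= iK];
    [exact: hJ|exact: hK].
move=> h; split => i /= iX.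
  by have := h i; rewrite /= inE iX => /(_ isT).
have := h i; rewrite /= inE iX orbT => /(_ isT).
by rewrite (disjointFl dJK iX).
Qed.

Variables (N : {set 'I_n}) (D : nat -> set R) (t : nat -> R) (lam a : R).
Hypothesis (a0 : 0 < a) (lam0 : 0 < lam) (t0 : 0 < t 0%N).
Hypothesis tS : forall r, t r <= t r.+1.
Hypothesis mD : forall r, measurable (D r).
Hypothesis DS : forall r, D r `<=` D r.+1.
Hypothesis PrD : forall r i, i \in N -> Pr (Y i @^-1` D r) = (t r)%:E.

(** The event that all points of [J] lie in [D r] and that their count meets the
line at one of the grid times up to [r]. Conditioning on the subset [J'] of
the points already present one step earlier makes it a finite union of
cylinders by construction, and is the shape to which the union bound
applies. *)
Fixpoint crossed (r : nat) (J : {set 'I_n}) : set Omega :=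
  if lam * t r + a <= #|J|%:R then cylinder J (fun=> D r) else
  match r with
  | 0 => set0
  | r'.+1 => \big[setU/set0]_(J' in powerset J)
      (crossed r' J' `&` cylinder (J :\: J') (fun=> D r `\` D r'))
  end.

Lemma crossed_measurable r J : measurable (crossed r J).
Proof.
elim: r J => [|r IHr] J /=; case: ifP => _ //; try exact: cylinder_measurable.
apply: bigsetU_measurable => J' _; apply: measurableI => //.
by apply: cylinder_measurable => i; apply: measurableD.
Qed.

Lemma grid_le r s : (r <= s)%N -> D r `<=` D s.
Proof.
move=> /subnK <-; elim: (s - r)%N => [|k IHk] //.
by rewrite addSn; apply: subset_trans IHk _.
Qed.

Lemma crossedP r r' (J : {set 'I_n}) w : (r' <= r)%N ->
  (forall i, i \in J -> D r (Y i w)) ->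
  lam * t r' + a <= #|[set i in J | `[< D r' (Y i w) >]]%SET|%:R ->
  crossed r J w.
Proof.
elim: r J => [|r IHr] J r'r JD hr' /=; case: ifPn => [_|hJ].
- by move=> i /= /JD.
- case/negP: hJ; apply: le_trans (_ : _ <= #|[set i in J | `[< D r' (Y i w) >]]%SET|%:R) _.
    by move: r'r hr'; rewrite leqn0 => /eqP ->.
  by rewrite ler_nat subset_leq_card //; apply/fintype.subsetP => i; rewrite inE => /andP[].
- by move=> i /= /JD.
have {}r'r : (r' <= r)%N.
  rewrite -ltnS ltn_neqAle r'r andbT; apply: contra hJ => /eqP <-.
  apply: le_trans hr' _; rewrite ler_nat subset_leq_card //.
  by apply/fintype.subsetP => i; rewrite inE => /andP[].
pose J' := [set i in J | `[< D r (Y i w) >]]%SET.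
rewrite -bigcup_pred; exists J'.
  by rewrite /= powersetE; apply/fintype.subsetP => i; rewrite inE => /andP[].
split.
  apply: IHr => // [i|]; first by rewrite inE => /andP[_ /asboolP].
  rewrite (_ : [set i in J' | _]%SET = [set i in J | `[< D r' (Y i w) >]]%SET) //.
  apply/setP => i; rewrite !inE; case: (i \in J) => //=.
  apply: andb_idl => /asboolP h; apply/asboolP; exact: grid_le h.
move=> i /=; rewrite !inE negb_and => /andP[/orP[/negP //|hD] iJ].
by split; [exact: JD|exact/asboolPn].
Qed.

Lemma Pr_step r i : i \in N -> p i (D r.+1 `\` D r) = t r.+1 - t r.
Proof.
move=> iN; rewrite /p.
have -> : Y i @^-1` (D r.+1 `\` D r) = Y i @^-1` D r.+1 `\` Y i @^-1` D r by [].
have mY s : measurable (Y i @^-1` D s) by exact: measurable_funPTI.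
have -> : Pr (Y i @^-1` D r.+1 `\` Y i @^-1` D r)
    = (Pr (Y i @^-1` D r.+1) - Pr (Y i @^-1` D r))%E.
  rewrite measureD //; last exact: le_lt_trans (probability_le1 _ _) (ltry 1).
  by congr (_ - Pr _)%E; apply/setIidPr => w; apply: DS.
by rewrite !PrD.
Qed.

Lemma grid_gt0 r : 0 < t r.
Proof. by elim: r => // r IHr; apply: lt_le_trans IHr (tS r). Qed.

(** The extra cylinder carries the positions of the points outside [J], which is
what independence has to provide when the induction passes from [J] to a
subset. After a union bound over the subsets, the sum is
[shifted_weight]. *)
Lemma Pr_crossed_cylinder r (J K : {set 'I_n}) (B : 'I_n -> set R) :
  J \subset N -> K \subset N -> [disjoint J & K]%B ->
  (forall i, measurable (B i)) ->
  (Pr (crossed r J `&` cylinder K B) <=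
   (crossing_weight a #|J| (lam * t r) / lam ^+ #|J|
     * \prod_(i in K) p i (B i))%:E)%E.
Proof.
have p0 i X : 0 <= p i X by rewrite /p fine_ge0.
have prod0 (L : {set 'I_n}) C : 0 <= \prod_(i in L) p i (C i).
  by apply: prodr_ge0.
have top r1 (L M : {set 'I_n}) C : L \subset N -> [disjoint L & M]%B ->
    (forall i, measurable (C i)) -> lam * t r1 + a <= #|L|%:R ->
    (Pr (cylinder L (fun=> D r1) `&` cylinder M C) <=
     (crossing_weight a #|L| (lam * t r1) / lam ^+ #|L|
     * \prod_(i in M) p i (C i))%:E)%E.
  move=> LN LM mC hL; rewrite cylinderI // Pr_cylinder; last first.
    by move=> i; case: ifP.
  rewrite lee_fin crossing_weight_top // exprMn [lam ^+ _ * _]mulrC.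
  rewrite mulfK ?expf_neq0 ?gt_eqF //.
  rewrite (eq_bigl [in [predU L & M]]); last by move=> i; rewrite !inE.
  rewrite bigU //=.
  rewrite (eq_bigr (fun=> t r1)); last first.
    by move=> i iL; rewrite iL /p PrD // (fintype.subsetP LN).
  rewrite prodr_const; apply: ler_wpM2l; first by rewrite exprn_ge0 // ltW // grid_gt0.
  rewrite le_eqVlt; apply/orP; left; apply/eqP; apply: eq_bigr => i iM.
  by rewrite (disjointFl LM iM).
elim: r J K B => [|r IHr] J K B JN KN JK mB /=; case: ifPn => hJ.
- exact: top.
- rewrite set0I measure0 lee_fin mulr_ge0 // divr_ge0 ?exprn_ge0 ?(ltW lam0) //.
  by rewrite crossing_weight_ge0 // mulr_ge0 // ltW // grid_gt0.
- exact: top.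
rewrite -bigcup_pred setI_bigcupl bigcup_pred.
set q := \prod_(i in K) p i (B i).
set dt := t r.+1 - t r.
pose E (J' : {set 'I_n}) (i : 'I_n) :=
  if i \in J :\: J' then D r.+1 `\` D r else B i.
have mE J' i : measurable (E J' i).
  by rewrite /E; case: ifP => // _; apply: measurableD.
apply: le_trans (measure_bigU_le _ _ _) _ => [J'|].
  apply: measurableI; last exact: cylinder_measurable.
  apply: measurableI; first exact: crossed_measurable.
  by apply: cylinder_measurable => i; apply: measurableD.
pose w (j : nat) := crossing_weight a j (lam * t r) / lam ^+ j
  * dt ^+ (#|J| - j) * q.
apply: (@le_trans _ _ (\sum_(J' in powerset J) w #|J'|)%:E).
  rewrite (big_morph EFin (@EFinD R) erefl); apply: lee_sum => J' J'J.
  rewrite powersetE in J'J.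
  have dJK : [disjoint J :\: J' & K]%B.
    apply: disjointWl JK; exact: finset.subsetDl.
  rewrite -setIA cylinderI // -/(E J').
  have dE : [disjoint J' & (J :\: J') :|: K]%B.
    rewrite finset.disjoints_subset; apply/fintype.subsetP => i iJ'.
    by rewrite !inE iJ' /= (disjointFr JK) // (fintype.subsetP J'J).
  apply: le_trans (IHr _ _ _ _ _ dE (mE J')) _.
  - exact: fintype.subset_trans J'J JN.
  - rewrite finset.subUset KN andbT.
    by apply: fintype.subset_trans JN; exact: finset.subsetDl.
  rewrite lee_fin /w -[leRHS]mulrA.
  rewrite (eq_bigl [in [predU J :\: J' & K]]); last by move=> i; rewrite !inE.
  rewrite bigU //=.
  rewrite le_eqVlt; apply/orP; left; apply/eqP; congr (_ * (_ * _)).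
    rewrite (eq_bigr (fun=> dt)) => [|i iJ].
      by rewrite prodr_const cardsD (finset.setIidPr J'J).
    rewrite /E iJ Pr_step // (fintype.subsetP JN) //.
    by move: iJ; rewrite inE => /andP[].
  by apply: eq_bigr => i iK; rewrite /E (disjointFl dJK iK).
rewrite lee_fin sum_subset_card.
have := @shifted_weight_le R a a0 (lam * t r) (lam * dt) #|J|.
rewrite mulr_gt0 ?grid_gt0 // mulr_ge0 ?(ltW lam0) ?subr_ge0 //.
move=> /(_ isT isT); rewrite -mulrDr addrC subrK => h.
have lamJ : 0 < lam ^+ #|J| by rewrite exprn_gt0.
apply: le_trans (_ : _ <= shifted_weight a (lam * t r) #|J| (lam * dt)
   / lam ^+ #|J| * q) _; last first.
  apply: ler_wpM2r; first exact: prod0.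
  by apply: ler_wpM2r => //; rewrite invr_ge0 ltW.
rewrite le_eqVlt; apply/orP; left; apply/eqP.
rewrite /shifted_weight -mulrA mulr_suml; apply: eq_bigr => j _.
rewrite /w exprMn mulrnAl; congr (_ *+ _).
have -> : lam ^+ #|J| = lam ^+ j * lam ^+ (#|J| - j).
  by rewrite -exprD subnKC // -ltnS.
by field; rewrite !expf_neq0 ?gt_eqF.
Qed.

Lemma Pr_crossed r : t r = 1 -> #|N|%:R <= lam + a ->
  (Pr (crossed r N) <= (expR (- crossing_rate a #|N|%:R lam))%:E)%E.
Proof.
move=> tr1 Nb.
have := @Pr_crossed_cylinder r N finset.set0 (fun=> setT).
rewrite fintype.subxx finset.sub0set => /(_ isT isT).
rewrite -setI_eq0 finset.setI0 eqxx => /(_ isT (fun=> measurableT)).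
rewrite big_set0 mulr1 tr1 mulr1 /crossing_weight Nb mulrAC divff ?mul1r; last first.
  by rewrite expf_neq0 // gt_eqF.
rewrite (_ : _ `&` _ = crossed r N) //; apply/setIidPl => w _ i /=.
by rewrite inE.
Qed.

End GridCrossing.

(** * The probability integral transform *)

Section ProbabilityIntegralTransform.
Context (R : realType).
Variables (mu : probability (measurableTypeR R) R) (F : R -> R).
Hypothesis muF : forall x : R, mu `]-oo, x]%classic = (F x)%:E.
Hypothesis cF : continuous F.

Lemma cdf_ndecr : {homo F : x y / x <= y}.
Proof.
move=> x y xy; rewrite -lee_fin -!muF le_measure ?inE //.
exact: subset_itvl.
Qed.

Lemma cdf_bounds (x : R) : 0 <= F x <= 1.
Proof. by rewrite -!lee_fin -!muF measure_ge0 probability_le1. Qed.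

Lemma cdf_lt (y x : R) : F y < F x -> y < x.
Proof. by rewrite !ltNge; apply: contra; exact: cdf_ndecr. Qed.

Lemma cdf_preimage_measurable (A : set R) : measurable A -> measurable (F @^-1` A).
Proof.
move=> mA; rewrite -[_ @^-1` _]setTI.
by apply: (continuous_measurable_fun cF).
Qed.

Lemma cdf_surj (t : R) : 0 < t < 1 -> exists q, F q = t.
Proof.
move=> /andP[t0 t1].
have [x xt] : exists x, F x < t.
  have : (fun k : nat => mu `]-oo, (- k%:R : R)]%classic) @ \oo -->
      mu (\bigcap_k `]-oo, (- k%:R : R)]%classic).
    apply: nonincreasing_cvg_mu => //=.
    + by rewrite (le_lt_trans (probability_le1 _ _)) ?ltry.
    + exact: bigcap_measurable.
    + move=> m k mk; apply/subsetPset; apply: subset_itvl.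
      by rewrite bnd_simp lerN2 ler_nat.
  rewrite (_ : \bigcap_k _ = set0); last first.
    rewrite -subset0 => z /(_ (Num.truncn `|z|).+1 I) /=.
    rewrite in_itv /= leNgt => /negP; apply; rewrite ltrNl.
    by rewrite (le_lt_trans (ler_norm _)) // normrN truncnS_gt.
  rewrite measure0 => /fine_cvgP[_ /cvgr_lt /(_ t t0)] [k _ /(_ k (leqnn k))] /=.
  by rewrite muF /= => h; exists (- k%:R).
have [y ty] : exists y, t < F y.
  have : (fun k : nat => mu `]-oo, (k%:R : R)]%classic) @ \oo -->
      mu (\bigcup_k `]-oo, (k%:R : R)]%classic).
    apply: nondecreasing_cvg_mu => //=; first exact: bigcup_measurable.
    move=> m k mk; apply/subsetPset; apply: subset_itvl.
    by rewrite bnd_simp ler_nat.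
  rewrite (_ : \bigcup_k _ = setT); last first.
    rewrite -subTset => z _; exists (Num.truncn z).+1 => //=.
    by rewrite in_itv /= ltW // truncnS_gt.
  rewrite probability_setT => /fine_cvgP[_ /cvgr_gt /(_ t t1)] [k _ /(_ k (leqnn k))] /=.
  by rewrite muF /= => h; exists k%:R.
have xy : x <= y by rewrite ltW // cdf_lt // (lt_trans xt).
have [|q _ <-] := @IVT R F x y t xy (continuous_subspaceT cF); last by exists q.
by rewrite ge_min le_max (ltW xt) (ltW ty) orbT.
Qed.

(** The upper bound compares with a level slightly above [t], which spares a
discussion of the flat parts of [F]. *)
Lemma cdf_transform_le (t : R) : 0 <= t <= 1 -> mu [set y | F y <= t] = t%:E.
Proof.
move=> /andP[t0 t1].
have mle s : measurable [set y | F y <= s].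
  rewrite (_ : [set y | _] = F @^-1` `]-oo, s]); first exact: cdf_preimage_measurable.
  by apply/seteqP; split => y /=; rewrite in_itv.
have lower (s : R) : 0 <= s <= 1 -> (s%:E <= mu [set y | (F y <= s)%R])%E.
  move=> /andP[]; rewrite le_eqVlt => /predU1P[<- //|s0].
  rewrite le_eqVlt => /predU1P[->|s1].
    rewrite (_ : [set y | _] = setT) ?probability_setT //.
    by rewrite -subTset => y _ /=; case/andP: (cdf_bounds y).
  have [|q Fq] := @cdf_surj s; first by rewrite s0.
  rewrite -Fq -muF; apply: le_measure; rewrite ?inE;
    [exact: measurable_itv|exact: mle|].
  by move=> y /=; rewrite in_itv /= => /cdf_ndecr.
apply/eqP; rewrite eq_le lower ?t0 // andbT.
apply/lee_addgt0Pr => e e0.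
have [te|te] := leP 1 (t + e).
  by apply: le_trans (probability_le1 mu (mle t)) _; rewrite -EFinD lee_fin.
have [|q Fq] := @cdf_surj (t + e); first by rewrite te andbT ltr_wpDl.
rewrite -EFinD -Fq -muF; apply: le_measure; rewrite ?inE;
  [exact: mle|exact: measurable_itv|].
move=> y /= Fyt; rewrite in_itv /= ltW // cdf_lt // Fq.
by rewrite (le_lt_trans Fyt) // ltrDl.
Qed.

Lemma cdf_transform_ge (t : R) : 0 <= t <= 1 -> mu [set y | 1 - F y <= t] = t%:E.
Proof.
move=> /andP[t0 t1].
have mlt : measurable [set y | F y < 1 - t].
  rewrite (_ : [set y | _] = F @^-1` `]-oo, 1 - t[); first exact: cdf_preimage_measurable.
  by apply/seteqP; split => y /=; rewrite in_itv.
have mle s : measurable [set y | F y <= s].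
  rewrite (_ : [set y | _] = F @^-1` `]-oo, s]); first exact: cdf_preimage_measurable.
  by apply/seteqP; split => y /=; rewrite in_itv.
have -> : [set y | 1 - F y <= t] = ~` [set y | F y < 1 - t].
  apply/seteqP; split => y /=; first by rewrite lerBlDr => h; rewrite ltrBrDl; lra.
  by move/negP; rewrite -leNgt; lra.
rewrite probability_setC //.
suff -> : mu [set y | F y < 1 - t] = (1 - t)%:E by rewrite -EFinB opprB addrC subrK.
apply/eqP; rewrite eq_le; apply/andP; split.
  rewrite -[leRHS](@cdf_transform_le (1 - t)); last by lra.
  by apply: le_measure; rewrite ?inE; [exact: mlt|exact: mle|move=> y; exact: ltW].
apply/lee_addgt0Pr => e e0.
have [te|te] := leP (1 - t - e) 0.
  apply: (@le_trans _ _ e%:E); first by rewrite lee_fin; lra.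
  by rewrite leeDr.
rewrite -leeBlDr // -EFinB -(@cdf_transform_le (1 - t - e)); last by lra.
by apply: le_measure; rewrite ?inE; [exact: mle|exact: mlt|move=> y /=; lra].
Qed.

End ProbabilityIntegralTransform.

(** * The normal distribution function *)

Section NormalCdf.
Context (R : realType).

Lemma normal_prob_itv (m s x : R) : 0 < s ->
  normal_prob m s `]-oo, x]%classic = (scaled_cdf m s x)%:E.
Proof.
move=> s0; rewrite /scaled_cdf /Phi fineK ?fin_num_measure //.
rewrite /normal_prob.
pose G (z : R) := (z - m) / s.
have dG (z : R) : is_derive z 1 G s^-1.
  apply: (is_derive_eq (is_deriveM (is_deriveB (is_derive_id z (1 : R))
    (is_derive_cst m z (1 : R))) (is_derive_cst s^-1 z (1 : R)))).
  by rewrite /GRing.scale /= mulr0 add0r subr0 mulr1.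
have G'E : G^`()%classic = cst s^-1.
  by apply/funext => z; rewrite derive1E; exact: derive_val.
have s'0 : 0 < s^-1 by rewrite invr_gt0.
have sn0 : s != 0 by rewrite gt_eqF.
rewrite -[(x - m) / s]/(G x).
rewrite (@increasing_ge0_integration_by_substitutionNy _ G (normal_pdf 0 1)).
- apply: eq_integral => z _; rewrite G'E /=; congr EFin.
  rewrite !fctE !normal_pdfE ?oner_neq0 // mulrAC; congr (_ * _).
    rewrite /normal_peak expr1n mul1r -mulrnAr sqrtrM ?sqr_ge0 // sqrtr_sqr.
    by rewrite gtr0_norm // invfM mulrC.
  rewrite /normal_fun /G; congr expR; rewrite subr0 expr1n; by field.
- by move=> y z _ _ yz; rewrite /G ltr_pM2r // ltrD2r.
- by rewrite G'E => z _; exact: cvg_cst.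
- by rewrite G'E; exact: is_cvg_cst.
- by rewrite G'E; exact: cvg_cst.
- split; first by move=> z _; exact: (@ex_derive _ _ _ _ _ _ _ (dG z)).
  apply: cvg_at_left_filter; apply: differentiable_continuous.
  by apply/derivable1_diffP; exact: (@ex_derive _ _ _ _ _ _ _ (dG x)).
- apply/gt0_cvgMlNy => //; exact: cvg_addrr_Ny.
- by apply: continuous_subspaceT; exact: continuous_normal_pdf (oner_neq0 _).
- by move=> z _; exact: normal_pdf_ge0.
Qed.

(** The density is bounded by its peak, hence the distribution function is
Lipschitz. *)
Lemma continuous_scaled_cdf (m s : R) : 0 < s -> continuous (scaled_cdf m s).
Proof.
move=> s0; have sn0 : s != 0 by rewrite gt_eqF.
pose K := normal_peak s.
have K0 : 0 < K by exact: normal_peak_gt0.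
have lip (y z : R) : y <= z -> 0 <= scaled_cdf m s z - scaled_cdf m s y <= K * (z - y).
  move=> yz; rewrite -!lee_fin EFinB -!normal_prob_itv //.
  have -> : (normal_prob m s `]-oo, z]%classic - normal_prob m s `]-oo, y]%classic
      = normal_prob m s `]y, z]%classic)%E.
    have -> : `]y, z]%classic = `]-oo, z]%classic `\` `]-oo, y]%classic :> set R.
      apply/seteqP; split => w /=; rewrite !in_itv /=.
        by move=> /andP[yw wz]; split => //; apply/negP; rewrite -ltNge.
      by move=> [wz /negP]; rewrite -ltNge wz andbT.
    rewrite measureD //; last by rewrite (le_lt_trans (probability_le1 _ _)) ?ltry.
    congr (_ - normal_prob m s _)%E; apply/esym/setIidPr.
    exact: subset_itvl.
  rewrite measure_ge0 /= /normal_prob.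
  apply: (@le_trans _ _ (\int[lebesgue_measure]_(w in `]y, z]%classic) K%:E)%E).
    apply: ge0_le_integral => //=.
    - by move=> w _; rewrite lee_fin normal_pdf_ge0.
    - apply: measurable_funTS; apply/measurable_EFinP; exact: measurable_normal_pdf.
    - by move=> w _; rewrite lee_fin normal_pdf_ub.
  rewrite integral_cst //= lebesgue_measure_itv /= lte_fin.
  case: ltP => yz'; first by rewrite EFinM.
  by rewrite mule0 lee_fin mulr_ge0 ?subr_ge0 // ltW.
have lip2 (y z : R) : `|scaled_cdf m s z - scaled_cdf m s y| <= K * `|z - y|.
  have [yz|/ltW zy] := leP y z.
    by have /andP[h1 h2] := lip _ _ yz; rewrite !ger0_norm // subr_ge0.
  rewrite distrC [X in _ * X]distrC.
  by have /andP[h1 h2] := lip _ _ zy; rewrite !ger0_norm // subr_ge0.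
move=> x; apply/cvgrPdist_le => e e0; near=> z.
apply: le_trans (lip2 _ _) _; rewrite -ler_pdivlMl // mulrC ltW //.
near: z; apply: cvgr_dist_lt; first exact: cvg_id.
by rewrite divr_gt0.
Unshelve. all: by end_near. Qed.

Lemma normal_transform (P : set R -> \bar R) (m s : R) : 0 < s ->
  same_law P (normal_prob m s) -> forall t : R, 0 <= t <= 1 ->
  P [set y | scaled_cdf m s y <= t] = t%:E /\
  P [set y | 1 - scaled_cdf m s y <= t] = t%:E.
Proof.
move=> s0 PN t t01; have cF := @continuous_scaled_cdf m s s0.
have muF x := @normal_prob_itv m s x s0.
have mF (A : set R) : measurable A -> measurable (scaled_cdf m s @^-1` A).
  exact: (@cdf_preimage_measurable R _ cF).
split; rewrite PN.
- exact: (@cdf_transform_le R (normal_prob m s) _ muF cF).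
- rewrite (_ : [set y | _] = scaled_cdf m s @^-1` `]-oo, t]); first exact: mF.
  by apply/seteqP; split => y /=; rewrite in_itv.
- exact: (@cdf_transform_ge R (normal_prob m s) _ muF cF).
- rewrite (_ : [set y | _] = scaled_cdf m s @^-1` `[1 - t, +oo[); first exact: mF.
  by apply/seteqP; split => y /=; rewrite in_itv /= andbT; lra.
Qed.

End NormalCdf.

(** * Crossing a line at an arbitrary point *)

Section LinearCrossing.
Context (d : measure_display) (Omega : measurableType d) (R : realType).
Variables (Pr : probability Omega R) (n : nat) (Y : 'I_n -> {RV Pr >-> R}).
Hypothesis indY : independent_RVs Y.
Variables (N : {set 'I_n}) (lam : R).
Hypothesis lam0 : 0 < lam.

Definition emp_count (F : R -> R) (w : Omega) (s : R) : nat :=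
  #|[set i in N | F (Y i w) <= s]%SET|.

Definition uniform_on (F : R -> R) :=
  [/\ forall y, F y <= 1, forall s, measurable [set y | F y <= s] &
  forall i s, i \in N -> 0 <= s <= 1 ->
     Pr (Y i @^-1` [set y | F y <= s]) = s%:E].

(** On a grid of mesh at most [e / lam] the line rises by at most [e] per step, so
that a crossing at any [s] is seen at the next grid time with [a] lowered by
[e]. The event [G] serves as a measurable cover of the crossings, which form an
uncountable union. *)
Lemma linear_crossing_cover (F : R -> R) (a e : R) : uniform_on F ->
  0 < e -> e < a -> #|N|%:R <= lam + (a - e) ->
  exists G, [/\ measurable G,
    (Pr G <= (expR (- crossing_rate (a - e) #|N|%:R lam))%:E)%E &
    forall w s, 0 <= s <= 1 -> lam * s + a < (emp_count F w s)%:R -> G w].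
Proof.
move=> [F1 mF PrF] e0 ea Na.
pose K := (Num.truncn (lam / e)).
have lamK : lam <= e * K.+1%:R.
  by rewrite -ler_pdivrMl // mulrC ltW // truncnS_gt.
have K0 : 0 < K.+1%:R :> R by rewrite ltr0n.
pose t (r : nat) : R := Num.min 1 (r.+1%:R / K.+1%:R).
have t01 r : 0 <= t r <= 1.
  by rewrite /t le_min ler01 divr_ge0 //= ge_min lexx.
pose D (r : nat) : set R := [set y | F y <= t r].
have t0 : 0 < t 0%N by rewrite /t lt_min ltr01 divr_gt0.
have tS r : t r <= t r.+1.
  rewrite /t le_min ge_min lexx /= ge_min orbC ler_pM2r ?invr_gt0 //.
  by rewrite ler_nat leqnSn.
have mD r : measurable (D r) by exact: mF.
have DS r : D r `<=` D r.+1 by move=> y /= h; exact: le_trans h (tS r).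
have PrD r i : i \in N -> Pr (Y i @^-1` D r) = (t r)%:E.
  by move=> iN; exact: PrF.
have tK : t K = 1 by rewrite /t divff ?gt_eqF // minxx.
exists (crossed Y D t lam (a - e) K N); split.
- exact: crossed_measurable.
- by apply: Pr_crossed => //; rewrite subr_gt0.
move=> w s /andP[s0 s1] hs.
pose r := minn (Num.truncn (s * K.+1%:R)) K.
have sK0 : 0 <= s * K.+1%:R by rewrite mulr_ge0 // ltW.
have /andP[tr1 tr2] := truncn_itv sK0.
have st : s <= t r.
  rewrite /r; case: (leqP (Num.truncn (s * K.+1%:R)) K) => h; last by rewrite tK.
  by rewrite /t le_min s1 ler_pdivlMr // ltW.
have ts : t r <= s + K.+1%:R^-1.
  rewrite /t ge_min; apply/orP; right.
  rewrite ler_pdivrMr // mulrDl mulVf ?gt_eqF // -natr1 lerD2r.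
  by apply: le_trans tr1; rewrite ler_nat geq_minl.
apply: (@crossedP _ _ _ _ _ _ _ _ _ _ _ K r) => //.
- by rewrite /r geq_minr.
- by move=> i _; rewrite /D /= tK.
apply: (@le_trans _ _ (emp_count F w s)%:R); last first.
  rewrite ler_nat; apply: subset_leq_card; apply/fintype.subsetP => i.
  rewrite !inE => /andP[-> Fs] /=; apply/asboolP; exact: le_trans Fs st.
apply: le_trans (ltW hs).
have h1 : lam * t r <= lam * (s + K.+1%:R^-1) by rewrite ler_pM2l.
have h2 : lam * K.+1%:R^-1 <= e by rewrite ler_pdivrMr.
have h3 : lam * t r <= lam * s + e by rewrite (le_trans h1) // mulrDr lerD2l.
by move: (lam * t r) (lam * s) h3 => x y h3; lra.
Qed.

Lemma linear_crossing_two_sided (F1 F2 : R -> R) (a : R) (E : set Omega) :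
  uniform_on F1 -> uniform_on F2 -> 0 < a -> #|N|%:R < lam + a ->
  measurable E ->
  (forall w, ~ E w -> exists2 s, 0 <= s <= 1 &
     lam * s + a < (emp_count F1 w s)%:R \/ lam * s + a < (emp_count F2 w s)%:R) ->
  (Pr (~` E) <= (2 * expR (- crossing_rate a #|N|%:R lam))%:E)%E.
Proof.
move=> U1 U2 a0 Na mE hE.
have mEC : measurable (~` E) by exact: measurableC.
have PrEC : Pr (~` E) = (fine (Pr (~` E)))%:E by rewrite fineK // fin_num_measure.
rewrite PrEC lee_fin.
pose g (e : R) := 2 * expR (- crossing_rate (a - e) #|N|%:R lam).
have cg : g e @[e --> 0^'+] --> 2 * expR (- crossing_rate a #|N|%:R lam).
  rewrite (_ : 2 * _ = g 0); last by rewrite /g subr0.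
  apply: cvg_at_right_filter.
  apply: differentiable_continuous; apply/derivable1_diffP.
  rewrite /g /crossing_rate; apply: ex_derive.
apply: (ler_cvg_to (cvg_cst _) cg); near=> e.
have e0 : 0 < e by near: e; exact: nbhs_right_gt.
have ea : e < a by near: e; exact: nbhs_right_lt.
have eN : e < lam + a - #|N|%:R by near: e; apply: nbhs_right_lt; rewrite subr_gt0.
have Nae : #|N|%:R <= lam + (a - e) by lra.
have [G1 [mG1 PG1 hG1]] := linear_crossing_cover U1 e0 ea Nae.
have [G2 [mG2 PG2 hG2]] := linear_crossing_cover U2 e0 ea Nae.
rewrite -lee_fin -PrEC.
apply: (@le_trans _ _ (Pr (G1 `|` G2))).
  apply: le_measure; rewrite ?inE //; first exact: measurableU.
  move=> w /hE [s s01 [h|h]]; [left; exact: hG1 h|right; exact: hG2 h].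
apply: le_trans (measureU2 _ mG1 mG2) _.
by rewrite /g mulr_natl mulr2n EFinD leeD.
Unshelve. all: by end_near. Qed.

End LinearCrossing.

(** * Order statistics and the tests defining the region *)

Lemma nth_sorted_down (R : realType) (p : pred R) (s : seq R) (l : nat) :
  (forall x y, x <= y -> p y -> p x) -> sorted <=%R s -> (l < size s)%N ->
  p (nth 0 s l) = (l < count p s)%N.
Proof.
move=> pdown; elim: s l => // x s IHs l /= xs.
have [px|px] := boolP (p x).
  rewrite add1n; case: l => [|l]; first by rewrite /= px.
  rewrite !ltnS /=; exact: IHs (path_sorted xs).
have fails z : z \in x :: s -> ~~ p z.
  rewrite inE => /predU1P[-> //|zs]; apply: contra px; apply: pdown.
  by move: xs; rewrite path_sortedE; [case/andP => /allP /(_ z zs)|exact: le_trans].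
move=> ls; rewrite (negbTE (fails _ (@mem_nth _ 0 (x :: s) l ls))).
rewrite add0n (_ : count p s = 0%N) //.
apply/eqP; rewrite -leqn0 leqNgt -has_count; apply/hasPn => z zs.
by apply: fails; rewrite inE zs orbT.
Qed.

Lemma nth_sort_down (R : realType) (n : nat) (p : pred R) (y : n.-tuple R)
    (l : nat) :
  (forall x z, x <= z -> p z -> p x) -> (l < n)%N ->
  p (nth 0 (sort <=%R y) l) = (l < #|[set i | p (tnth y i)]%SET|)%N.
Proof.
move=> pdown ln; rewrite nth_sorted_down //; last 2 first.
- exact: sort_sorted le_total _.
- by rewrite size_sort size_tuple.
rewrite (permP (permEl (perm_sort _ _))) cardE /enum_mem size_filter.
rewrite -[X in (_ < count _ X)%N](map_tnth_enum y) count_map enumT.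
by congr (_ < _)%N; apply: eq_count => i /=; rewrite inE.
Qed.


(** The conventions for division by zero make the cases [d = 0] and [0 < d]
agree: for [d = 0] the left side says [A <= 0 <= B]. *)
Lemma ext_quot_le (R : realType) (A B d : R) : 0 <= d ->
  (maxe 0%E (ext_quot A d) <= mine 1%E (ext_quot B d))%E =
  [&& A <= B, A <= d & 0 <= B].
Proof.
move=> d0; rewrite ge_max !le_min lee01 /= /ext_quot.
have [d_eq|dn0] := eqVneq d 0.
  rewrite d_eq.
  by case: (ltgtP 0 A) => hA; case: (ltgtP 0 B) => hB;
    rewrite ?lexx ?leey ?leNye ?lee01 ?andbT ?andbF ?leye_eq ?leeNy_eq //=;
    apply/esym/idP; lra.
have d_gt0 : 0 < d by rewrite lt_def dn0.
rewrite !lee_fin ler_pdivrMr // mul1r ler_pM2r ?invr_gt0 //.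
rewrite pmulr_lge0 ?invr_gt0 //.
by case: (0 <= B); case: (A <= d); case: (A <= B).
Qed.

Section ConfRegion.
Variables (R : realType) (n : nat) (k alpha : R).
Hypothesis k0 : 0 <= k.

(** The conditions that a pair of order statistics imposes on the scaling, freed
from the running extrema, the truncations to [[0, 1]] and the quotient. *)
Definition band_test (y : n.-tuple R) (F : R -> R) (l' l : nat) : bool :=
  let A := a_term k y F l' - c_na n k alpha in
  let B := b_term k y F l + c_na n k alpha in
  [&& A <= B, A <= k / n%:R & 0 <= B].

Lemma conf_regionP (y : n.-tuple R) (u s : R) :
  conf_region k alpha y (u, s) <->
  0 < s /\ forall l' l, (l' <= l <= n)%N -> band_test y (scaled_cdf u s) l' l.
Proof.
set F := scaled_cdf u s; set c := c_na n k alpha.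
have d0 : 0 <= k / n%:R by rewrite divr_ge0.
rewrite /conf_region /=; split => -[s0 h]; split => //.
  move=> l' l /andP[l'l ln].
  have := h l' (leq_trans l'l ln).
  rewrite /a_hat /b_hat ext_quot_le // => /and3P[].
  rewrite -/F -/c => h1 h2 h3.
  have hA : a_term k y F l' <=
      \big[Num.max/a_term k y F 0]_(0 <= l < l'.+1) a_term k y F l.
    by apply: le_bigmax_seq => //; rewrite mem_index_iota /= leqnn.
  have hB : \big[Num.min/b_term k y F n]_(l' <= l < n.+1) b_term k y F l
      <= b_term k y F l.
    by apply: ge_bigmin_seq => //; rewrite mem_index_iota l'l ltnS.
  rewrite /band_test -/c.
  by apply/and3P; split; [lra|apply: le_trans h2; rewrite lerD2r|
    apply: le_trans h3 _; rewrite lerD2r].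
move=> j jn; rewrite /a_hat /b_hat ext_quot_le //.
have maxP X : (forall l', (l' <= j)%N -> a_term k y F l' <= X) ->
    \big[Num.max/a_term k y F 0]_(0 <= l < j.+1) a_term k y F l <= X.
  move=> hX; rewrite big_seq; apply: bigmax_le; first exact: hX.
  by move=> l; rewrite mem_index_iota ltnS /= => lj; apply: hX.
have minP X : (forall l, (j <= l <= n)%N -> X <= b_term k y F l) ->
    X <= \big[Num.min/b_term k y F n]_(j <= l < n.+1) b_term k y F l.
  move=> hX; rewrite big_seq; apply: le_bigmin; first by apply: hX; rewrite jn leqnn.
  by move=> l; rewrite mem_index_iota ltnS => lj; apply: hX.
have ltest l' l : (l' <= j)%N -> (j <= l <= n)%N -> band_test y F l' l.
  by move=> l'j /andP[jl ln]; apply: h; rewrite ln (leq_trans l'j).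
apply/and3P; split.
- rewrite lerBlDr; apply: maxP => l' l'j; rewrite -lerBlDr -lerBlDr.
  apply: minP => l lj; rewrite lerBlDr.
  by case/and3P: (ltest l' l l'j lj).
- rewrite lerBlDr; apply: maxP => l' l'j; rewrite -lerBlDr.
  by case/and3P: (ltest l' n l'j (introT andP (conj jn (leqnn n)))).
- rewrite -lerBlDr; apply: minP => l lj; rewrite lerBlDr.
  by case/and3P: (ltest 0%N l (leq0n j) lj).
Qed.

End ConfRegion.

Section OrderStatistics.
Variables (R : realType) (n : nat) (y : n.-tuple R).

Lemma card_le_order_stat l : (l <= n)%N ->
  (l <= #|[set i | ((tnth y i)%:E <= order_stat y l)%E]%SET|)%N.
Proof.
case: l => // l ln; rewrite /order_stat /= ln /=.
pose p := [pred x : R | x <= nth 0 (sort <=%R y) l].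
have pdown x z : x <= z -> p z -> p x by move=> /= xz; exact: le_trans.
have := nth_sort_down y pdown ln; rewrite /= lexx => /esym h.
by rewrite (eq_card (B := [set i | p (tnth y i)]%SET)) // => i; rewrite !inE lee_fin.
Qed.

Lemma card_lt_order_stat l : (l <= n)%N ->
  (#|[set i | ((tnth y i)%:E < order_stat y l.+1)%E]%SET| <= l)%N.
Proof.
rewrite leq_eqVlt => /predU1P[->|ln].
  by rewrite -[leqRHS]card_ord max_card.
rewrite /order_stat /= ln /=.
pose p := [pred x : R | x < nth 0 (sort <=%R y) l].
have pdown x z : x <= z -> p z -> p x by move=> /= xz; exact: le_lt_trans.
have := nth_sort_down y pdown ln; rewrite /= ltxx => /esym /negbT; rewrite -leqNgt => h.
by rewrite (eq_card (B := [set i | p (tnth y i)]%SET)) // => i; rewrite !inE lte_fin.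
Qed.

Lemma cdf_left_continuous (F : R -> R) (x : \bar R) :
  continuous F -> cdf_left F x = cdf_at F x.
Proof.
move=> cF; case: x => [r| |] //=; apply/cvg_lim => //.
by apply: cvg_at_left_filter; exact: cF.
Qed.

End OrderStatistics.

Section Measurability.
Context (d : measure_display) (Omega : measurableType d) (R : realType).
Variables (Pr : probability Omega R) (n : nat) (Y : 'I_n -> {RV Pr >-> R}).

Lemma measurable_order_stat l : (l < n)%N ->
  measurable_fun setT (fun w => nth 0 (sort <=%R (sample Y w)) l : R).
Proof.
move=> ln; apply: (measurability _ (RGenInftyO.measurableE R)) => //.
move=> _ [_ [x ->] <-]; rewrite setTI.
pose p := [pred z : R | z < x].
have pdown v z : v <= z -> p z -> p v by move=> /= vz; exact: le_lt_trans.
have key w : (nth 0 (sort <=%R (sample Y w)) l < x) =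
    (l < #|[set i | (Y i w < x)%R]%SET|)%N.
  have /= -> := nth_sort_down (sample Y w) pdown ln.
  by congr (_ < _)%N; apply: eq_card => i; rewrite !inE tnth_mktuple.
rewrite (_ : _ @^-1` _ = \big[setU/set0]_(J in [pred J : {set 'I_n} | (l < #|J|)%N])
    cylinder Y J (fun=> `]-oo, x[%classic)).
  by apply: bigsetU_measurable => J _; apply: cylinder_measurable.
rewrite -bigcup_pred; apply/seteqP; split => w.
  rewrite /preimage /mkset /= in_itv /= => h.
  exists [set i | Y i w < x]%SET; first by rewrite /= inE -key.
  by move=> i /=; rewrite inE in_itv.
move=> [J /= lJ hJ]; rewrite in_itv -[X in is_true X]/(nth 0 (sort <=%R (sample Y w)) l < x) key.
apply: leq_trans lJ _; apply: subset_leq_card; apply/fintype.subsetP => i iJ.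
by have := hJ i iJ; rewrite inE /= in_itv.
Qed.

Variables (k alpha : R) (F : R -> R).
Hypothesis cF : continuous F.

Lemma measurable_cdf_order_stat l :
  measurable_fun setT (fun w => cdf_at F (order_stat (sample Y w) l)).
Proof.
case: l => [|l]; first exact: measurable_cst.
have [ln|ln] := boolP (l < n)%N; last first.
  rewrite (_ : (fun w => _) = cst 1) //.
  by apply/funext => w; rewrite /order_stat (negbTE ln).
rewrite (_ : (fun w => _) = F \o (fun w => nth 0 (sort <=%R (sample Y w)) l));
  last by apply/funext => w; rewrite /order_stat ln.
apply: (measurableT_comp (continuous_measurable_fun cF)).
exact: measurable_order_stat.
Qed.

Lemma measurable_band_test l' l :
  measurable [set w | band_test k alpha (sample Y w) F l' l].
Proof.
pose A w := a_term k (sample Y w) F l' - c_na n k alpha.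
pose B w := b_term k (sample Y w) F l + c_na n k alpha.
have mA : measurable_fun setT A.
  apply: measurable_funB; last exact: measurable_cst.
  apply: measurable_funB; first exact: measurable_cst.
  by apply: measurable_funM; [exact: measurable_cst|exact: measurable_cdf_order_stat].
have mB : measurable_fun setT B.
  apply: measurable_funD; last exact: measurable_cst.
  apply: measurable_funB; first exact: measurable_cst.
  apply: measurable_funM; first exact: measurable_cst.
  rewrite (_ : (fun w => _) = fun w => cdf_at F (order_stat (sample Y w) l.+1)).
    exact: measurable_cdf_order_stat.
  by apply/funext => w; exact: cdf_left_continuous.
rewrite (_ : [set w | _] = (setT `&` [set w | A w <= B w]) `&`
  ((setT `&` [set w | A w <= cst (k / n%:R) w]) `&` (setT `&` [set w | cst 0 w <= B w]))).
  apply: measurableI; first exact: measurable_fun_le.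
  by apply: measurableI; apply: measurable_fun_le => //; exact: measurable_cst.
apply/seteqP; split => w /=; rewrite /band_test -/(A w) -/(B w).
  by case/and3P.
by move=> [[_ h1] [[_ h2] [_ h3]]]; rewrite h1 h2.
Qed.

End Measurability.

(** * Tilted lines *)

(** Here [l] and [l'] are ranks, [s] and [s'] the corresponding values of the
distribution function, [A] and [A'] the numbers of outliers to the left of the
two points. If [L * (s' - s) <= 2 * c], the first conclusion follows from the
order of the ranks; otherwise [2 * c * t = L * x] gives [x <= t * (s' - s)],
so that the tilt outweighs the offsets [x] of the two lines. *)
Lemma tilted_band (R : realType) (L f c x t n1 s s' A A' l l' : R) :
  0 < L -> 0 <= t -> x + t = f -> 2 * c * t = L * x ->
  0 <= s <= 1 -> 0 <= s' <= 1 -> 0 <= A' -> A <= n1 -> (s < s' -> A <= A') ->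
  0 < c -> l <= l' ->
  l <= (L + t) * s + (c + x) + A ->
  L + f + A' - ((L + t) * (1 - s') + (c + x)) <= l' ->
  [/\ l - L * s - c <= l' - L * s' + c, l - L * s - c <= f + n1 &
      0 <= l' - L * s' + c].
Proof.
move=> L0 t0 xt ct /andP[s0 s1] /andP[s'0 s'1] A'0 An1 AA' c0 ll' hl hl'.
have ts1 : t * s <= t by rewrite ler_piMr.
have ts0 : 0 <= t * s' by rewrite mulr_ge0.
split; [|lra|lra].
have [h|h] := leP (L * (s' - s)) (2 * c); first lra.
have ss' : s < s' by rewrite -subr_gt0 -(pmulr_rgt0 _ L0); lra.
have /AA' {}AA' := ss'.
have xs : x <= t * (s' - s).
  rewrite -(ler_pM2l L0) -ct mulrCA mulrC; apply: ler_wpM2l => //; lra.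
lra.
Qed.

Lemma cdf_at_le (R : realType) (F : R -> R) (x z : \bar R) :
  {homo F : u v / u <= v} -> (forall u, 0 <= F u <= 1) ->
  (x <= z)%E -> cdf_at F x <= cdf_at F z.
Proof.
move=> Fm F01; case: x => [x| |]; case: z => [z| |] //=; rewrite ?lee_fin.
- exact: Fm.
- by case/andP: (F01 x).
- by case/andP: (F01 z).
Qed.

Lemma cdf_at_bounds (R : realType) (F : R -> R) (x : \bar R) :
  (forall u, 0 <= F u <= 1) -> 0 <= cdf_at F x <= 1.
Proof. by move=> F01; case: x => [x| |] //=; rewrite lexx ler01. Qed.

(** The points on the left of an order statistic are split into nulls, which are
controlled by the count of their transforms, and outliers, of which there are
at most [#|~: N|]. For the lower bound the nulls are counted from the
right. *)
Lemma band_test_of_tilted_counts (R : realType) (n : nat) (k alpha x t : R)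
    (y : n.-tuple R) (N : {set 'I_n}) (F : R -> R) :
  continuous F -> {homo F : u v / u <= v} -> (forall u, 0 <= F u <= 1) ->
  let L := n%:R - k in let c := n%:R * c_na n k alpha in
  0 < L -> 0 < c -> 0 <= k -> 0 <= t -> x + t = k - #|~: N|%:R ->
  2 * c * t = L * x ->
  (forall s, 0 <= s <= 1 ->
    #|[set i in N | F (tnth y i) <= s]%SET|%:R <= (L + t) * s + (c + x)) ->
  (forall s, 0 <= s <= 1 ->
    #|[set i in N | 1 - F (tnth y i) <= s]%SET|%:R <= (L + t) * s + (c + x)) ->
  forall l' l, (l' <= l <= n)%N -> band_test k alpha y F l' l.
Proof.
move=> cF Fm F01 L c L0 c0 k0 t0 xt ct hU hL l' l /andP[l'l ln].
have n0 : 0 < n%:R :> R by apply: lt_le_trans L0 _; rewrite gerBl.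
set f := k - _ in xt.
pose u := order_stat y l'; pose v := order_stat y l.+1.
pose out := #|[set i | ((tnth y i)%:E <= u)%E]%SET :\: N|.
pose out' := #|[set i | ((tnth y i)%:E < v)%E]%SET :\: N|.
have NC : n%:R = #|N|%:R + #|~: N|%:R :> R.
  by rewrite -natrD cardsC card_ord.
have hl' : l'%:R <= (L + t) * cdf_at F u + (c + x) + out%:R.
  have := card_le_order_stat y (leq_trans l'l ln).
  rewrite -(cardsID N) => h.
  apply: le_trans (_ : _ <= (#|[set i | ((tnth y i)%:E <= u)%E]%SET :&: N| + out)%:R) _.
    by rewrite ler_nat.
  rewrite natrD lerD2r; apply: le_trans (hU _ (cdf_at_bounds u F01)).
  rewrite ler_nat; apply: subset_leq_card; apply/fintype.subsetP => i.
  rewrite !inE => /andP[iu ->] /=.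
  by have := cdf_at_le Fm F01 iu.
have hl : L + f + out'%:R - ((L + t) * (1 - cdf_at F v) + (c + x)) <= l%:R.
  have S01 : 0 <= 1 - cdf_at F v <= 1.
    by have := cdf_at_bounds v F01; lra.
  have h := hL _ S01.
  have sub : (#|N| <= #|[set i | ((tnth y i)%:E < v)%E]%SET :&: N| +
      #|[set i in N | (1 - F (tnth y i) <= 1 - cdf_at F v)%R]%SET|)%N.
    apply: leq_trans (leq_card_setU _ _).
    apply: subset_leq_card; apply/fintype.subsetP => i iN.
    rewrite !inE iN andbT /=; case: ltP => //= vi.
    by rewrite lerD2l lerN2; have := cdf_at_le Fm F01 vi.
  have := card_lt_order_stat y ln; rewrite -(cardsID N) -/out' => h'.
  have e1 : #|[set i | ((tnth y i)%:E < v)%E]%SET :&: N|%:R + out'%:R <= l%:R :> R.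
    by rewrite -natrD ler_nat.
  have e2 : #|N|%:R <= #|[set i | ((tnth y i)%:E < v)%E]%SET :&: N|%:R +
      #|[set i in N | 1 - F (tnth y i) <= 1 - cdf_at F v]%SET|%:R :> R.
    by rewrite -natrD ler_nat.
  have e3 : L + f = #|N|%:R by rewrite /L /f NC; ring.
  lra.
have outN : out%:R <= #|~: N|%:R :> R.
  rewrite ler_nat; apply: subset_leq_card; apply/fintype.subsetP => i.
  by rewrite !inE => /andP[].
have out_le : cdf_at F u < cdf_at F v -> out%:R <= out'%:R :> R.
  move=> uv; have {}uv : (u < v)%E.
    by rewrite ltNge; apply: contraTN uv => vu; rewrite -leNgt cdf_at_le.
  rewrite ler_nat; apply: subset_leq_card; apply/fintype.subsetP => i.
  by rewrite !inE => /andP[-> iu] /=; exact: le_lt_trans iu uv.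
have := @tilted_band R L f c x t #|~: N|%:R (cdf_at F u) (cdf_at F v) out%:R out'%:R
  l'%:R l%:R L0 t0 xt ct (cdf_at_bounds u F01) (cdf_at_bounds v F01) (ler0n _ _)
  outN out_le c0.
rewrite ler_nat => /(_ l'l hl' hl) [t1 t2 t3].
have ec : c_na n k alpha = c / n%:R by rewrite /c mulrC mulKf // gt_eqF.
have ea : a_term k y F l' = (l'%:R - L * cdf_at F u) / n%:R.
  by rewrite /a_term -/u /L; field; rewrite gt_eqF.
have eb : b_term k y F l = (l%:R - L * cdf_at F v) / n%:R.
  by rewrite /b_term cdf_left_continuous // -/v /L; field; rewrite gt_eqF.
rewrite /band_test ea eb ec -mulrBl -mulrDl !ler_pM2r ?invr_gt0 //.
rewrite t1 /= pmulr_lge0 ?invr_gt0 // t3 andbT.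
by move: t2; rewrite /f subrK.
Qed.

(** For the tilted line the right gap is exactly [c]. After clearing denominators
the claim is [6 L >= 3 L + 2 c]. *)
Lemma tilted_rate_ge (R : realType) (L f c x t : R) :
  0 < L -> 0 <= f -> 0 < c -> x = 2 * c * f / (L + 2 * c) ->
  t = L * f / (L + 2 * c) -> 2 * c <= 3 * L ->
  2 * c ^+ 2 / L <= crossing_rate (c + x) (L + f) (L + t).
Proof.
move=> L0 f0 c0 -> -> cL; set q := L + 2 * c.
have q0 : 0 < q by rewrite /q; lra.
set x' := 2 * c * f / q; set t' := L * f / q.
have xt : x' + t' = f by rewrite /x' /t' /q; field; rewrite gt_eqF // /q in q0 *; lra.
have x0 : 0 <= x' by rewrite divr_ge0 ?mulr_ge0 // ltW.
have t0 : 0 <= t' by rewrite divr_ge0 ?mulr_ge0 // ltW.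
have S0 : 0 < (L + t') *+ 2 + (L + f) by lra.
rewrite /crossing_rate.
have -> : L + t' + (c + x') - (L + f) = c by rewrite -xt; ring.
rewrite ler_pdivlMr // mulrAC ler_pdivrMr //.
rewrite -subr_ge0.
have -> : 6 * (c + x') * c * L - 2 * c ^+ 2 * ((L + t') *+ 2 + (L + f)) =
   2 * c * (3 * (L * x') - c * (f + 2 * t')) by ring.
rewrite mulr_ge0 ?mulr_ge0 ?(ltW c0) // subr_ge0.
have -> : 3 * (L * x') = c * (6 * L * f / q) by rewrite /x'; field; rewrite gt_eqF.
rewrite ler_pM2l //.
have -> : f + 2 * t' = f * (3 * L + 2 * c) / q.
  by rewrite /t' /q; field; rewrite gt_eqF.
rewrite ler_pM2r ?invr_gt0 // [leRHS]mulrC; apply: ler_wpM2l => //; lra.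
Qed.

(** * Coverage *)

Lemma majority_true_scaling (R : realType) (n : nat) (P : product_law R n) :
  in_calP P -> majority_null P (thetaP P, sigmaP P).
Proof.
move=> hP; rewrite /thetaP /sigmaP -surjective_pairing.
exact: xgetPex hP.
Qed.

Section Coverage.
Context (d : measure_display) (Omega : measurableType d) (R : realType).
Variables (Pr : probability Omega R) (n : nat) (Y : 'I_n -> {RV Pr >-> R}).
Variables (alpha k theta sigma : R).
Hypothesis (k0 : 0 <= k) (s0 : 0 < sigma).

Definition coverage_event : set Omega :=
  [set w | conf_region k alpha (sample Y w) (theta, sigma)].

Lemma measurable_coverage_event : measurable coverage_event.
Proof.
have cF := @continuous_scaled_cdf R theta sigma s0.
rewrite (_ : coverage_event =
  \bigcap_(p in [set p : 'I_n.+1 * 'I_n.+1 | (p.1 <= p.2)%N])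
    [set w | band_test k alpha (sample Y w) (scaled_cdf theta sigma) p.1 p.2]).
  apply: fin_bigcap_measurable; first exact: finite_finset.
  by move=> p _; exact: measurable_band_test.
apply/seteqP; split => w.
  move=> /(conf_regionP _ k0)[_ h] [l' l] /= l'l; apply: h.
  by rewrite l'l -ltnS ltn_ord.
move=> h; apply/(conf_regionP _ k0); split => // l' l /andP[l'l ln].
have l'n := leq_trans l'l ln.
by have := h (Ordinal (l'n : (l' < n.+1)%N), Ordinal (ln : (l < n.+1)%N)) l'l.
Qed.

Lemma uniform_scaled_cdf (P : product_law R n) (N : {set 'I_n}) :
  (forall i, same_law (distribution Pr (Y i)) (P i)) ->
  (forall i, i \in N -> same_law (P i) (normal_prob theta sigma)) ->
  uniform_on Y N (scaled_cdf theta sigma) /\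
  uniform_on Y N (fun y => 1 - scaled_cdf theta sigma y).
Proof.
move=> YP PN.
have cF := @continuous_scaled_cdf R theta sigma s0.
have F01 := cdf_bounds (fun x => @normal_prob_itv R theta sigma x s0).
have law i : i \in N -> same_law (distribution Pr (Y i)) (normal_prob theta sigma).
  by move=> iN A mA; rewrite (YP i A mA) (PN i iN A mA).
split; split => [y|s|i s iN s01].
- by case/andP: (F01 y).
- rewrite (_ : [set y | _] = scaled_cdf theta sigma @^-1` `]-oo, s]).
    exact: cdf_preimage_measurable.
  by apply/seteqP; split => y /=; rewrite in_itv.
- by have [] := normal_transform s0 (law i iN) s01.
- by rewrite gerBl; case/andP: (F01 y).
- rewrite (_ : [set y | _] = scaled_cdf theta sigma @^-1` `[1 - s, +oo[).
    exact: cdf_preimage_measurable.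
  by apply/seteqP; split => y /=; rewrite in_itv /= andbT; lra.
- by have [] := normal_transform s0 (law i iN) s01.
Qed.

End Coverage.

Theorem corollary6p4 (R : realType) (n : nat) (alpha k : R)
    (d : measure_display) (Omega : measurableType d)
    (Pr : probability Omega R) (Y : 'I_n -> {RV Pr >-> R})
    (P : product_law R n)
    (halpha : 0 < alpha < 1) (hk : 0 <= k < n%:R / 2)
    (hP : in_calP P) (hY : has_product_law Y P)
    (hn1 : (n1 P)%:R <= k) :
  (* the true scaling lies in the region with probability >= 1 - alpha *)
  (let E := [set w | conf_region k alpha (sample Y w) (thetaP P, sigmaP P)] in
   measurable E /\ ((1 - alpha)%:E <= Pr E)%E) /\
  (* on an event of probability >= 1 - alpha, the oracle procedure is one of
     the procedures BH(u, s), (u, s) in the region *)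
  (exists A : set Omega,
     [/\ measurable A, ((1 - alpha)%:E <= Pr A)%E &
         forall w, A w ->
           exists2 us : R * R, conf_region k alpha (sample Y w) us &
             oracle_BH alpha P = BH alpha us.1 us.2]).
Proof.
set E := [set w | _].
suff [mE PE] : measurable E /\ ((1 - alpha)%:E <= Pr E)%E.
  split=> //; exists E; split=> // w Ew.
  by exists (thetaP P, sigmaP P).
have [s0 _] := majority_true_scaling hP; rewrite /= in s0.
case/andP: halpha => al0 al1; case/andP: hk => k0 kn.
have [indY YP] := hY.
have mE : measurable E by exact: measurable_coverage_event.
split=> //.
set F := scaled_cdf (thetaP P) (sigmaP P).
pose N := Defs.null_set P (thetaP P) (sigmaP P).
have PN i : i \in N -> same_law (P i) (normal_prob (thetaP P) (sigmaP P)).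
  by rewrite inE => /asboolP.
have [U1 U2] := uniform_scaled_cdf s0 YP PN.
have cF : continuous F by exact: continuous_scaled_cdf.
have muF x := @normal_prob_itv R (thetaP P) (sigmaP P) x s0.
pose L : R := n%:R - k; pose f : R := k - (n1 P)%:R.
pose c : R := n%:R * c_na n k alpha.
have L0 : 0 < L by rewrite /L; lra.
have f0 : 0 <= f by rewrite subr_ge0.
have n0 : 0 < n%:R :> R by rewrite /L in L0; lra.
pose ell : R := - ln (alpha / 2).
have ell0 : 0 < ell.
  rewrite oppr_gt0 ln_lt0 // divr_gt0 //=.
  by rewrite ltr_pdivrMr //; lra.
have c2 : c ^+ 2 = L * ell / 2.
  rewrite /c exprMn /c_na sqr_sqrtr; last first.
    rewrite mulNr -mulrN divr_ge0 ?mulr_ge0 ?(ltW ell0) ?(ltW n0) //.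
    by rewrite subr_ge0 ler_pdivrMr //; lra.
  by rewrite /ell /L; field; rewrite gt_eqF.
have c0 : 0 < c.
  rewrite lt_def mulr_ge0 ?sqrtr_ge0 ?(ltW n0) // andbT.
  apply: contraTneq (ell0) => ceq.
  have : L * ell / 2 = 0 by rewrite -c2 ceq expr0n.
  by move/eqP; rewrite !mulf_eq0 invr_eq0 pnatr_eq0 orbF gt_eqF //= => /eqP ->; rewrite ltxx.
pose q := L + 2 * c; have q0 : 0 < q by rewrite /q; lra.
pose x := 2 * c * f / q; pose t := L * f / q.
have t0 : 0 <= t by rewrite divr_ge0 ?mulr_ge0 // ltW.
have x0 : 0 <= x by rewrite divr_ge0 ?(ltW q0) // mulr_ge0 // mulr_ge0 // ltW.
have xt : x + t = f.
  by rewrite -mulrDl -mulrDl addrC mulrAC mulfV ?mul1r // gt_eqF.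
have ct : 2 * c * t = L * x by rewrite /x /t; ring.
have NM : #|N|%:R = L + f :> R.
  have -> : L + f = n%:R - (n1 P)%:R by rewrite /L /f; ring.
  by rewrite -[in n%:R](card_ord n) -(cardsC N) natrD addrK.
pose lam := L + t; pose a := c + x.
have lam0 : 0 < lam by rewrite ltr_wpDr.
have a0 : 0 < a by rewrite ltr_wpDr.
have countE G w s : emp_count Y N G w s =
    #|[set i in N | (G (tnth (sample Y w) i) <= s)%R]%SET|.
  by apply: eq_card => i; rewrite !inE tnth_mktuple.
have cross w : ~ E w -> exists2 s, 0 <= s <= 1 &
     lam * s + a < (emp_count Y N F w s)%:R \/
     lam * s + a < (emp_count Y N (fun y => 1 - F y) w s)%:R.
  apply: contra_notP => hw; rewrite /E /=; apply/(conf_regionP _ k0); split => //.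
  apply: (@band_test_of_tilted_counts R n k alpha x t _ N) => //.
  - exact: cdf_ndecr muF.
  - exact: cdf_bounds muF.
  - move=> s s01; rewrite leNgt -(countE F); apply/negP => hs.
    by apply: hw; exists s => //; left.
  - move=> s s01; rewrite leNgt -(countE (fun y => 1 - F y)); apply/negP => hs.
    by apply: hw; exists s => //; right.
(* For a very large [c] the lines start above the total number of nulls. *)
have [cL|Lc] := leP (2 * c) (3 * L); last first.
  have Ma : #|N|%:R <= a.
    have : 3 * f <= 4 * x.
      rewrite /x mulrA ler_pdivlMr //.
      have := ler_wpM2r f0 (ltW Lc); rewrite /q; lra.
    rewrite NM /a; have : f <= L by rewrite /f /L; have := ler0n R (n1 P); lra.
    lra.
  rewrite (_ : E = setT) ?probability_setT ?lee_fin; first lra.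
  rewrite -subTset => w _; apply: contrapT => /cross [s /andP[s00 _]].
  have la : a <= lam * s + a by rewrite lerDr mulr_ge0 // ltW.
  have few G : (emp_count Y N G w s)%:R <= #|N|%:R :> R.
    rewrite ler_nat; apply: subset_leq_card; apply/fintype.subsetP => i.
    by rewrite inE => /andP[].
  by case=> h; have := lt_le_trans h (le_trans (few _) (le_trans Ma la)); rewrite ltxx.
have Na : #|N|%:R < lam + a by rewrite NM /lam /a -xt; lra.
have bound := linear_crossing_two_sided indY lam0 U1 U2 a0 Na mE cross.
have rate : ell <= crossing_rate a #|N|%:R lam.
  rewrite NM; apply: le_trans (tilted_rate_ge L0 f0 c0 erefl erefl cL).
  by rewrite c2 le_eqVlt; apply/orP; left; apply/eqP; field; rewrite gt_eqF.
have : (Pr (~` E) <= alpha%:E)%E.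
  apply: le_trans bound _; rewrite lee_fin.
  have -> : alpha = 2 * expR (- ell).
    by rewrite opprK lnK ?posrE ?divr_gt0 // mulrC divfK.
  by rewrite ler_pM2l // ler_expR lerN2.
rewrite probability_setC // leeBlDr ?fin_num_measure // => h.
by rewrite EFinB leeBlDl.
Qed.
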